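(* Let $\alpha\in(0,1)$, $T>0$, $n\in\mathbb{N}$, $R_0>0$, and let $f:[0,T]\times\mathbb{R}^n\to\mathbb{R}^n$ satisfy the following conditions: (i) for any $x\in\mathbb{R}^n$, the function $f(\cdot,x)$ is measurable on $[0,T]$; (ii) for any $r>0$ there exists $\lambda_f>0$ such that $\|f(t,x)-f(t,y)\|\le\lambda_f\|x-y\|$ for all $t\in[0,T]$ and all $x,y\in B(r)$; (iii) there exists $c_f>0$ such that $\|f(t,x)\|\le(1+\|x\|)c_f$ for all $t\in[0,T]$ and all $x\in\mathbb{R}^n$. Then for any $\varepsilon>0$ there exists $h_\ast>0$ such that, for any $x_0\in B(R_0)$ and any $h\in(0,h_\ast]$, the solution $x(\cdot)=x(\cdot;x_0)$ of the Cauchy problem $$({}^CD^\alpha x)(t)=f(t,x(t)),\quad t\in[0,T],\qquad x(0)=x_0,$$ and the solution $y(\cdot)=y(\cdot;x_0;h)$ of the approximating Cauchy problem $$\dot y(t)=f\big(t,\,x_0+h^{\alpha-1}(\Delta_h^{1-\alpha}y)(t)\big),\quad t\in[0,T],\qquad y(0)=0,$$ satisfy the inequality $$\|x(t)-x_0-h^{\alpha-1}(\Delta_h^{1-\alpha}y)(t)\|\le\varepsilon,\quad t\in[0,T].$$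
   Context: $\mathbb{R}^n$ carries the Euclidean norm $\|\cdot\|$; $B(r)$ is the closed ball in $\mathbb{R}^n$ centered at the origin with radius $r$. $L^\infty=L^\infty([0,T],\mathbb{R}^n)$ is the space of (classes of) essentially bounded Lebesgue measurable functions $[0,T]\to\mathbb{R}^n$. Riemann–Liouville integral: $(I^\alpha\varphi)(t)=\frac{1}{\Gamma(\alpha)}\int_0^t\frac{\varphi(\tau)}{(t-\tau)^{1-\alpha}}d\tau$, $t\in[0,T]$. $I^\alpha(L^\infty)$ is the set of functions $x:[0,T]\to\mathbb{R}^n$ such that $x(t)=(I^\alpha\varphi)(t)$ for all $t\in[0,T]$ for some $\varphi\in L^\infty$. $\{x_0\}+I^\alpha(L^\infty)$ is the set of functions $t\mapsto x_0+\overline{x}(t)$ with $\overline{x}(\cdot)\in I^\alpha(L^\infty)$; such functions automatically take the value $x_0$ at $t=0$. Caputo derivative: $({}^CD^\alpha x)(t)=\frac{1}{\Gamma(1-\alpha)}\frac{d}{dt}\int_0^t\frac{x(\tau)-x(0)}{(t-\tau)^\alpha}d\tau$; it exists for almost every $t\in[0,T]$ when $x(\cdot)\in\{x_0\}+I^\alpha(L^\infty)$. Fractional difference of order $\beta\in(0,1)$ with step $h>0$: $(\Delta_h^\beta y)(t)=\sum_{j=0}^{[t/h]}(-1)^j\binom{\beta}{j}y(t-jh)$, $t\in[0,T]$, where $[\tau]$ is the integer part of $\tau\ge0$ and $\binom{\beta}{j}$ are the generalized binomial coefficients. A solution of the fractional Cauchy problem is a function $x(\cdot)\in\{x_0\}+I^\alpha(L^\infty)$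 satisfying the fractional differential equation for almost every $t\in[0,T]$. A solution of the approximating Cauchy problem is a Lipschitz continuous function $y:[0,T]\to\mathbb{R}^n$ with $y(0)=0$ satisfying its differential equation for almost every $t\in[0,T]$. Under conditions (i)–(iii), for every $x_0\in B(R_0)$ and $h>0$ each of these two problems has exactly one solution, denoted $x(\cdot;x_0)$ and $y(\cdot;x_0;h)$ respectively. *)

(* Defs.v *)
(* MathComp-Analysis, over an arbitrary realType. *)
From HB Require Import structures.
From mathcomp Require Import all_boot all_order all_algebra.
From mathcomp Require Import all_classical all_reals all_analysis.

Set Implicit Arguments.
Unset Strict Implicit.
Unset Printing Implicit Defensive.

Import Order.TTheory GRing.Theory Num.Theory.
Import numFieldNormedType.Exports.

Local Open Scope classical_set_scope.
Local Open Scope ring_scope.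

(* R^n is 'rV[R]_n.  A function on [0, T] is represented by a total function of
   a real variable of which only the values on [0, T] matter: every condition
   is imposed on [0, T] only, and derivatives are taken only at almost every
   point of [0, T], so that the end points play no role. *)

(* The library norm on 'rV[R]_n is the sup norm. *)
Definition enorm (R : realType) (n : nat) (v : 'rV[R]_n) : R :=
  Num.sqrt (\sum_(i < n) v ord0 i ^+ 2).

Definition eball (R : realType) (n : nat) (r : R) : set 'rV[R]_n :=
  [set v | enorm v <= r].
Arguments eball {R} n r.

(* The library's lebesgue_measure is defined on the Borel sets only; Lebesgue
   measurability and the Lebesgue integral of Lebesgue measurable functions are
   those of its completion.  leb_type R is R with the Lebesgue sigma-algebra. *)
Notation leb_type R := (caratheodory_type (wlength (@idfun R))^*%mu).
Notation leb_measure R := (@completed_lebesgue_measure R).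

Definition vmeasurable (R : realType) (n : nat) (D : set R) (g : R -> 'rV[R]_n)
    : Prop :=
  forall i : 'I_n,
    measurable_fun (D : set (leb_type R)) (fun t : leb_type R => g t ord0 i).

Definition vintegral (R : realType) (n : nat) (D : set R) (g : R -> 'rV[R]_n)
    : 'rV[R]_n :=
  \row_(i < n) \int[leb_measure R]_(t in (D : set (leb_type R))) g t ord0 i.

(* L^oo([0, T], R^n), before passing to classes of a.e. equal functions; the
   integrals below do not depend on the representative. *)
Definition Linfty (R : realType) (n : nat) (T : R) : set (R -> 'rV[R]_n) :=
  [set phi | vmeasurable `[0, T] phi /\
    exists M : R,
      {ae leb_measure R, forall t : R, t \in `[0, T] -> enorm (phi t) <= M}].
Arguments Linfty {R} n T.

Definition Gamma (R : realType) (a : R) : R :=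
  \int[leb_measure R]_(s in (`]0, +oo[ : set (leb_type R)))
    (s `^ (a - 1) * expR (- s)).

(* In the two kernels below, the value of the library's powR and inverse at the
   singularity tau = t is immaterial. *)
Definition RL_integral (R : realType) (n : nat) (alpha : R)
    (phi : R -> 'rV[R]_n) (t : R) : 'rV[R]_n :=
  (Gamma alpha)^-1 *:
    vintegral `[0, t] (fun tau => ((t - tau) `^ (1 - alpha))^-1 *: phi tau).

(* The set {x0} + I^alpha(L^oo); its elements take the value x0 at 0. *)
Definition x0_plus_I_Linfty (R : realType) (n : nat) (alpha T : R)
    (x0 : 'rV[R]_n) : set (R -> 'rV[R]_n) :=
  [set x | exists2 phi, Linfty n T phi &
    forall t : R, t \in `[0, T] -> x t = x0 + RL_integral alpha phi t].

Definition caputo_primitive (R : realType) (n : nat) (alpha : R)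
    (x : R -> 'rV[R]_n) (t : R) : 'rV[R]_n :=
  vintegral `[0, t] (fun tau => ((t - tau) `^ alpha)^-1 *: (x tau - x 0)).

(* Meaningful where caputo_primitive alpha x is derivable. *)
Definition caputo (R : realType) (n : nat) (alpha : R)
    (x : R -> 'rV[R]_n) (t : R) : 'rV[R]_n :=
  (Gamma (1 - alpha))^-1 *: derive1 (caputo_primitive alpha x) t.

Definition gbinom (R : realType) (b : R) (j : nat) : R :=
  (\prod_(i < j) (b - i%:R)) / j`!%:R.

Definition frac_diff (R : realType) (n : nat) (h beta : R)
    (y : R -> 'rV[R]_n) (t : R) : 'rV[R]_n :=
  \sum_(j < (Num.truncn (t / h)).+1)
    ((-1) ^+ j * gbinom beta j) *: y (t - j%:R * h).

Definition caputo_solution (R : realType) (n : nat) (alpha T : R)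
    (f : R -> 'rV[R]_n -> 'rV[R]_n) (x0 : 'rV[R]_n) (x : R -> 'rV[R]_n)
    : Prop :=
  x0_plus_I_Linfty alpha T x0 x /\
  {ae leb_measure R, forall t : R, t \in `[0, T] ->
     derivable (caputo_primitive alpha x) t 1 /\
     caputo alpha x t = f t (x t)}.

Definition lipschitz_on_itv (R : realType) (n : nat) (T : R)
    (y : R -> 'rV[R]_n) : Prop :=
  exists L : R, forall s t : R, s \in `[0, T] -> t \in `[0, T] ->
    enorm (y s - y t) <= L * `|s - t|.

Definition approx_solution (R : realType) (n : nat) (alpha T h : R)
    (f : R -> 'rV[R]_n -> 'rV[R]_n) (x0 : 'rV[R]_n) (y : R -> 'rV[R]_n)
    : Prop :=
  [/\ lipschitz_on_itv T y, y 0 = 0 &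
      {ae leb_measure R, forall t : R, t \in `[0, T] ->
         derivable y t 1 /\
         derive1 y t =
           f t (x0 + h `^ (alpha - 1) *: frac_diff h (1 - alpha) y t)}].

(* Main.v *)
Require Import Defs.
From HB Require Import structures.
From mathcomp Require Import all_boot all_order all_algebra.
From mathcomp Require Import all_classical all_reals all_analysis.
From mathcomp Require Import measurable_realfun ring lra.

Set Implicit Arguments.
Unset Strict Implicit.
Unset Printing Implicit Defensive.

Import Order.TTheory GRing.Theory Num.Theory.
Import numFieldNormedType.Exports.

Local Open Scope classical_set_scope.
Local Open Scope ring_scope.

(* Let a_k(x) be the coefficient of z ^ k in (1 - z) ^ (- x).  Abel summation turns
   h ^ (alpha - 1) times the fractional difference of order 1 - alpha of y into
   the sum over k of the weights h ^ (alpha - 1) a_k(alpha) times the increments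
   of y over the cells [t - (k+1) h, t - k h].  Log-convexity of Gamma gives
   (k+1) ^ (alpha - 1) <= Gamma(alpha) a_k(alpha) <= k ^ (alpha - 1), so these
   weights are close to the Riemann-Liouville kernel and the sum is within
   O(h ^ (alpha / 2)) of the fractional integral of y'.
   If x = x0 + I^alpha phi, the identity I^(1 - alpha) I^alpha phi = F, with F the
   primitive of phi, shows that the Caputo derivative of x is F' almost everywhere;
   hence F' = f(t, x) and y' = f(t, x0 + z) almost everywhere, where x - x0 and
   z are the images of F and y under the same difference operator, up to
   O(h ^ (alpha / 2)).  A Gronwall inequality with an exponential weight, applied
   to these sums, first bounds x and z uniformly in x0 and h, and then x - x0 - z. *)

(** * The Euclidean norm *)

(** The first comparison of [rl] with [fdiff] costs a bound on the density phi of x, and no such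
    bound is known to be uniform in x0. This dictates the order of the argument. The comparison is
    restated with a Lipschitz constant of the primitive alone. Then x is bounded by running the
    Gronwall inequality at an auxiliary step, fine enough for this particular x, which leaves no
    trace in the bound. The equation now gives the primitive a Lipschitz constant uniform in x0, and
    only with this constant is the error at step h uniform. On the side of y there is no
    discretization error: x0 + z is exactly the argument of f in the approximating equation, so it
    remains to estimate the operator of step h on the difference Y - y of the primitive and y.
    Derivatives are controlled almost everywhere only; a mean value inequality for Lipschitz
    functions turns them into bounds on the increments over cells. The exponential weight makes the
    total mass of the discounted coefficients small, so that the estimate closes on all of [0, T] at
    once. *)

Section Enorm.
Context {R : realType} {n : nat}.
Implicit Types (u v w : 'rV[R]_n).

Lemma rV_coordB u v i : (u - v) ord0 i = u ord0 i - v ord0 i.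
Proof. by rewrite !mxE. Qed.

Lemma enorm_ge0 v : 0 <= enorm v.
Proof. exact: sqrtr_ge0. Qed.

Lemma sqr_enorm v : enorm v ^+ 2 = \sum_(i < n) v ord0 i ^+ 2.
Proof. by rewrite /enorm sqr_sqrtr// sumr_ge0// => i _; exact: sqr_ge0. Qed.

Lemma enorm0 : enorm (0 : 'rV[R]_n) = 0.
Proof.
rewrite /enorm.
by rewrite big1 ?sqrtr0// => i _; rewrite mxE expr0n.
Qed.

Lemma enormZ (a : R) v : enorm (a *: v) = `|a| * enorm v.
Proof.
apply/(@pexpIrn _ 2) => //; rewrite ?nnegrE ?mulr_ge0 ?enorm_ge0//.
rewrite exprMn !sqr_enorm real_normK ?num_real// mulr_sumr.
by apply: eq_bigr => i _; rewrite mxE exprMn.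
Qed.

Lemma enormN v : enorm (- v) = enorm v.
Proof. by rewrite -scaleN1r enormZ normrN1 mul1r. Qed.

Lemma enormB u v : enorm (u - v) = enorm (v - u).
Proof. by rewrite -enormN opprB. Qed.

Lemma le_coord_enorm v i : `|v ord0 i| <= enorm v.
Proof.
rewrite -(@ler_pXn2r _ 2)// ?nnegrE ?enorm_ge0// sqr_enorm real_normK ?num_real//.
by rewrite (bigD1 i)//= lerDl sumr_ge0// => j _; exact: sqr_ge0.
Qed.

(** Expand the nonnegative sum of the squares of |v| u_i - |u| v_i and divide by 2 |u| |v|; if a
    norm is zero, so are all its coordinates. *)
Lemma enorm_cauchy_schwarz u v :
  \sum_(i < n) u ord0 i * v ord0 i <= enorm u * enorm v.
Proof.
have [u0|u0] := eqVneq (enorm u) 0.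
  rewrite u0 mul0r big1// => i _.
  have := le_coord_enorm u i; rewrite u0 normr_le0 => /eqP ->.
  by rewrite mul0r.
have [v0|v0] := eqVneq (enorm v) 0.
  rewrite v0 mulr0 big1// => i _.
  have := le_coord_enorm v i; rewrite v0 normr_le0 => /eqP ->.
  by rewrite mulr0.
have up : 0 < enorm u by rewrite lt0r u0 enorm_ge0.
have vp : 0 < enorm v by rewrite lt0r v0 enorm_ge0.
have : 0 <= \sum_(i < n) (enorm v * u ord0 i - enorm u * v ord0 i) ^+ 2.
  by apply: sumr_ge0 => i _; exact: sqr_ge0.
under eq_bigr => i _ do rewrite sqrrB !exprMn.
rewrite big_split/= sumrB -mulr_sumr -sqr_enorm -mulr_sumr -sqr_enorm.
set s := \sum_(i < n) u _ i * _.
have -> : \sum_(i < n) enorm v * u ord0 i * (enorm u * v ord0 i) *+ 2 =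
    2 * (enorm u * enorm v) * s.
  by rewrite mulr_sumr; apply: eq_bigr => i _; ring.
move=> H.
have {}H : 2 * (enorm u * enorm v) * s <= 2 * (enorm u * enorm v) * (enorm u * enorm v).
  by rewrite -subr_ge0; move: H; congr (_ <= _); ring.
by rewrite -(@ler_pM2l _ (2 * (enorm u * enorm v)))// !mulr_gt0.
Qed.

Lemma enormD u v : enorm (u + v) <= enorm u + enorm v.
Proof.
rewrite -(@ler_pXn2r _ 2)// ?nnegrE ?addr_ge0 ?enorm_ge0// sqr_enorm sqrrD.
under eq_bigr => i _ do rewrite mxE sqrrD.
rewrite !big_split/= -!sqr_enorm lerD2r lerD2l.
by rewrite mulr2n lerD// enorm_cauchy_schwarz.
Qed.

Lemma enorm_sum (I : finType) (F : I -> 'rV[R]_n) :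
  enorm (\sum_i F i) <= \sum_i enorm (F i).
Proof.
elim/big_ind2 : _ => //; first by rewrite enorm0.
by move=> x1 x2 y1 y2 h1 h2; apply: le_trans (enormD _ _) (lerD _ _).
Qed.

Lemma enorm_le_sum v : enorm v <= \sum_(i < n) `|v ord0 i|.
Proof.
have s0 : 0 <= \sum_(i < n) `|v ord0 i| by apply: sumr_ge0.
rewrite -(@ler_pXn2r _ 2)// ?nnegrE ?enorm_ge0//.
rewrite sqr_enorm expr2 mulr_suml; apply: ler_sum => i _.
rewrite -[v ord0 i ^+ 2]real_normK ?num_real// expr2 ler_wpM2l//.
by rewrite (bigD1 i)//= lerDl sumr_ge0.
Qed.

Lemma enorm_le_cst v (c : R) :
  (forall i, `|v ord0 i| <= c) -> enorm v <= n%:R * c.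
Proof.
move=> vc; apply: le_trans (enorm_le_sum v) _.
have -> : n%:R * c = \sum_(i < n) c by rewrite sumr_const card_ord mulr_natl.
by apply: ler_sum => i _; exact: vc.
Qed.

End Enorm.

(** * Generalized binomial coefficients *)

Section Acoef.
Context {R : realType}.
Implicit Types (x y : R).

(* [acoef x k] is the coefficient of z ^ k in (1 - z) ^ (- x). *)
Definition acoef x (k : nat) : R := \prod_(i < k) ((x + i%:R) / i.+1%:R).

Lemma acoef0 x : acoef x 0 = 1.
Proof. by rewrite /acoef big_ord0. Qed.

Lemma acoefS x k : acoef x k.+1 = acoef x k * ((x + k%:R) / k.+1%:R).
Proof. by rewrite /acoef big_ord_recr. Qed.

Lemma acoefS_mul x k : k.+1%:R * acoef x k.+1 = (x + k%:R) * acoef x k.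
Proof.
rewrite acoefS mulrCA [X in _ * X]mulrCA divff ?pnatr_eq0// mulr1.
by rewrite mulrC.
Qed.

(** Both sides are x (x + 1) ... (x + k) / k!. *)
Lemma acoef_1D x k : x * acoef (x + 1) k = (x + k%:R) * acoef x k.
Proof.
elim: k => [|k IH]; first by rewrite !acoef0 addr0.
rewrite !acoefS mulrA IH -(natr1 k); field.
by rewrite natr1 pnatr_eq0.
Qed.

(** Dividing the generating function (1 - z)^(-x) by 1 - z sums its coefficients and shifts x by
    one. *)
Lemma sum_acoef x k : \sum_(j < k.+1) acoef x j = acoef (x + 1) k.
Proof.
elim: k => [|k IH]; first by rewrite big_ord_recr big_ord0/= !acoef0 add0r.
rewrite big_ord_recr/= IH (acoefS (x + 1)).
have k0 : k.+1%:R != 0 :> R by rewrite pnatr_eq0.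
apply: (mulfI k0); rewrite mulrDr acoefS_mul -acoef_1D.
by rewrite -(natr1 k) in k0 *; field.
Qed.

(** The generating functions of the two sequences multiply. *)
Lemma acoef_vandermonde x y m :
  \sum_(j < m.+1) acoef x j * acoef y (m - j) = acoef (x + y) m.
Proof.
elim: m => [|m IH]; first by rewrite big_ord_recr big_ord0/= !acoef0 add0r mulr1.
have m0 : m.+1%:R != 0 :> R by rewrite pnatr_eq0.
apply: (mulfI m0); rewrite acoefS_mul -IH.
(* Leibniz rule for z d/dz: the factor m + 1 splits as j + (m + 1 - j), and the recurrence lowers
   the index of the coefficient on which each part falls. *)
transitivity (\sum_(j < m.+2) j%:R * acoef x j * acoef y (m.+1 - j) +
   \sum_(j < m.+2) acoef x j * ((m.+1 - j)%:R * acoef y (m.+1 - j))).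
  rewrite -big_split mulr_sumr; apply: eq_bigr => -[j /= jm] _.
  rewrite natrB//; ring.
rewrite big_ord_recl/= !mul0r add0r [X in _ + X]big_ord_recr/=.
rewrite subnn mul0r mulr0 addr0 -big_split mulr_sumr.
apply: eq_bigr => -[j /= jm] _.
rewrite -[bump _ _]/(j.+1) acoefS_mul subSS subSn// acoefS_mul natrB//; ring.
Qed.

Lemma acoef_0 k : acoef 0 k.+1 = 0.
Proof. by rewrite /acoef big_ord_recl/= add0r !mul0r. Qed.

Lemma gbinom_acoef x j : (-1) ^+ j * gbinom x j = acoef (- x) j.
Proof.
rewrite /gbinom /acoef; elim: j => [|j IH].
  by rewrite !big_ord0 expr0 fact0 divff ?mulr1 ?oner_eq0.
rewrite !big_ord_recr/= -IH factS natrM exprS.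
have j0 : j.+1%:R != 0 :> R by rewrite pnatr_eq0.
have jf : j`!%:R != 0 :> R by rewrite pnatr_eq0 -lt0n fact_gt0.
by rewrite -(natr1 j) in j0 *; field; rewrite jf j0.
Qed.

Lemma acoef_gt0 x k : 0 < x -> 0 < acoef x k.
Proof.
move=> x0; apply: prodr_gt0 => i _.
by rewrite divr_gt0// ?ltr0n// ltr_wpDr.
Qed.

(* Only the zeroth of these coefficients is positive, and the partial sums are
   positive. *)
Lemma sum_normr_acoef x k : 0 < x < 1 ->
  \sum_(j < k) `|acoef (x - 1) j| <= 2.
Proof.
move=> /andP[x0 x1]; case: k => [|k]; first by rewrite big_ord0.
rewrite big_ord_recl/= acoef0 normr1.
have neg j : `|acoef (x - 1) j.+1| = - acoef (x - 1) j.+1.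
  rewrite ler0_norm// -(ler_pM2l (ltr0Sn R j)) mulr0 acoefS_mul.
  rewrite -acoef_1D subrK.
  by rewrite mulr_le0_ge0 ?subr_le0 ?ltW// acoef_gt0.
under eq_bigr => j _ do rewrite -[bump 0 j]/(j.+1) neg.
have := sum_acoef (x - 1) k; rewrite subrK big_ord_recl/= acoef0 => E.
have := acoef_gt0 k x0; rewrite -E.
rewrite sumrN.
under eq_bigr => j _ do rewrite -[bump 0 j]/(j.+1).
by move=> ?; lra.
Qed.

(** Summation by parts, the partial sums of [acoef x] being [acoef (x + 1)]. In general the
    right-hand side is the sum of the [acoef x j *: (G j - G P)], whose boundary value is zero
    here. *)
Lemma abel_sum (V : lmodType R) x (G : nat -> V) P :
  G P = 0 ->
  \sum_(j < P) acoef x j *: G j =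
  \sum_(k < P) acoef (x + 1) k *: (G k - G k.+1).
Proof.
have -> : \sum_(k < P) acoef (x + 1) k *: (G k - G k.+1) =
    \sum_(j < P) acoef x j *: (G j - G P).
  elim: P => [|P IH]; first by rewrite !big_ord0.
  rewrite big_ord_recr/= IH -sum_acoef scaler_suml [in RHS]big_ord_recr/=.
  rewrite [X in _ + X]big_ord_recr/= addrA; congr (_ + _).
  rewrite -big_split; apply: eq_bigr => j _ /=.
  by rewrite -scalerDr addrA subrK.
by move=> ->; apply: eq_bigr => j _; rewrite subr0.
Qed.

End Acoef.

(** * Elementary inequalities for real powers *)

Section PowR.
Context {R : realType}.
Implicit Types (x y a : R).

(** Young's inequality for x^a * 1 with exponents 1/a and 1/(1 - a): the concave power lies below
    its tangent at 1. *)
Lemma powR_le_affine x a : 0 <= x -> 0 < a < 1 -> x `^ a <= 1 - a + a * x.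
Proof.
move=> x0 /andP[a0 a1].
have b0 : 0 < 1 - a by rewrite subr_gt0.
have := @conjugate_powR R (x `^ a) 1 a^-1 (1 - a)^-1 (powR_ge0 _ _) ler01.
rewrite !invr_gt0 !invrK => /(_ a0 b0).
rewrite addrC subrK => /(_ erefl).
by rewrite mulr1 -powRrM divff ?gt_eqF// powRr1// powR1 mul1r addrC mulrC.
Qed.

Lemma powR_gt0_le_inv x y a : 0 < x -> x <= y -> a <= 0 -> y `^ a <= x `^ a.
Proof.
move=> x0 xy a0; have y0 := lt_le_trans x0 xy.
rewrite -[a]opprK (powRN x (- a)) (powRN y (- a)) lef_pV2 ?posrE ?powR_gt0//.
by apply: ge0_ler_powR; rewrite ?oppr_ge0// ?nnegrE ltW.
Qed.

(** Discrete form of the integral of s^(a - 1): the increment of P^a / a dominates the new term, by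
    the tangent bound at P / (P + 1). *)
Lemma sum_powR_le a P : 0 < a < 1 ->
  \sum_(k < P) k.+1%:R `^ (a - 1) <= P%:R `^ a / a.
Proof.
move=> a01; have /andP[a0 a1] := a01.
elim: P => [|P IH].
  by rewrite big_ord0 divr_ge0 ?powR_ge0// ltW.
rewrite big_ord_recr/=; apply: le_trans (lerD IH (lexx _)) _.
rewrite ler_pdivlMr// mulrDl divfK ?gt_eqF//.
have P0 : (0 : R) < P.+1%:R by rewrite ltr0n.
have -> : P%:R `^ a = P.+1%:R `^ a * (P%:R / P.+1%:R) `^ a.
  by rewrite -powRM ?divr_ge0// mulrCA divff ?mulr1// pnatr_eq0.
have -> : P.+1%:R `^ (a - 1) = P.+1%:R `^ a / P.+1%:R :> R.
  by rewrite powRB ?powRr1// pnatr_eq0 implybT.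
rewrite -mulrA -mulrDr -[leRHS]mulr1 ler_wpM2l ?powR_ge0//.
have := @powR_le_affine (P%:R / P.+1%:R) a (divr_ge0 (ler0n _ _) (ler0n _ _)) a01.
rewrite -lerBrDr => /le_trans; apply.
rewrite -(natr1 P) in P0 *.
have -> : a * (P%:R / (P%:R + 1)) = a * (1 - (P%:R + 1)^-1).
  by congr (_ * _); field; rewrite gt_eqF.
by rewrite mulrBr mulr1 mulrC; lra.
Qed.

End PowR.

Section FTC.
Context {R : realType}.
Notation mu := (@lebesgue_measure R).

Lemma FTC2_is_derive (f F : R -> R) (a b : R) : a < b ->
  (forall x, a <= x <= b -> is_derive x 1 F (f x)) ->
  (forall x, a <= x <= b -> {for x, continuous f}) ->
  (\int[mu]_(x in `[a, b]) (f x)%:E = (F b)%:E - (F a)%:E)%E.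
Proof.
move=> ab dF cf.
have cF x : a <= x <= b -> {for x, continuous F}.
  move=> /dF[dFx _]; apply: differentiable_continuous.
  exact/derivable1_diffP.
apply: continuous_FTC2 => //.
- apply: continuous_in_subspaceT => x /[!inE]/=; rewrite in_itv/=; exact: cf.
- split.
  + by move=> x /[!in_itv]/= /andP[/ltW ax /ltW xb]; have [] := dF x; rewrite ?ax.
  + apply: cvg_at_right_filter; apply: cF; rewrite lexx ltW//.
  + apply: cvg_at_left_filter; apply: cF; rewrite lexx andbT ltW//.
- move=> x /[!in_itv]/= /andP[/ltW ax /ltW xb].
  have [|_ <-] := dF x; first by rewrite ax.
  by rewrite derive1E.
Qed.

End FTC.

(** * The Gamma function *)

Section GammaFun.
Context {R : realType}.
Notation mu := (@lebesgue_measure R).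
Local Open Scope ereal_scope.

Definition gamma_integrand (a s : R) : R := (s `^ (a - 1) * expR (- s))%R.

(** Extended-real valued, so that the functional equation and comparisons come first and finiteness
    is deduced from them. *)
Definition egamma (a : R) : \bar R :=
  \int[mu]_(s in `]0%R, +oo[) (gamma_integrand a s)%:E.

(** Compact intervals exhausting the half-line away from the singularity; n + 2 makes them
    nondegenerate from n = 0 on. *)
Let J (n : nat) : set R := [set` `[n.+2%:R^-1, n.+2%:R]%R].

Lemma gamma_integrand_ge0 a s : (0 <= gamma_integrand a s)%R.
Proof. by rewrite mulr_ge0 ?powR_ge0 ?expR_ge0. Qed.

Lemma continuous_gamma_integrand a s : (0 < s)%R ->
  {for s, continuous (gamma_integrand a)}.
Proof.
move=> s0; apply: continuousM.
  apply: differentiable_continuous; apply/derivable1_diffP.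
  by apply: derivable_powR; rewrite in_itv/= s0.
by apply: continuous_comp; [exact: continuousN|exact: continuous_expR].
Qed.

Lemma measurable_gamma_integrand a :
  measurable_fun (`]0%R, +oo[ : set R) (gamma_integrand a).
Proof.
apply: open_continuous_measurable_fun => //.
by move=> s /[!inE]/=; rewrite in_itv/= andbT => /continuous_gamma_integrand; exact.
Qed.

Let J_sub n : J n `<=` `]0%R, +oo[.
Proof.
move=> x; rewrite /J/= !in_itv/= andbT => /andP[h _].
by apply: lt_le_trans h; rewrite invr_gt0.
Qed.

Let bigcup_J : \bigcup_n J n = `]0%R, +oo[%classic.
Proof.
apply/seteqP; split=> [x [n _] /J_sub//|x].
rewrite /J/= in_itv/= andbT => x0.
exists (maxn (Num.truncn x) (Num.truncn x^-1)) => //=.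
rewrite in_itv/=; apply/andP; split.
  rewrite -[leRHS]invrK lef_pV2 ?posrE ?invr_gt0//.
  apply: le_trans (ltW (truncnS_gt _)) _.
  by rewrite ler_nat ltnS (leq_trans (leq_maxr _ _) (leqnSn _)).
apply: le_trans (ltW (truncnS_gt _)) _.
by rewrite ler_nat ltnS (leq_trans (leq_maxl _ _) (leqnSn _)).
Qed.

Let cvg_J a :
  \int[mu]_(x in J n) (gamma_integrand a x)%:E @[n --> \oo] --> egamma a.
Proof.
rewrite /egamma -bigcup_J; apply: ge0_nondecreasing_set_cvg_integral => //.
- apply/nondecreasing_seqP => n; rewrite subsetEset => x.
  rewrite /J/= !in_itv/= => /andP[h1 h2]; apply/andP; split.
    by apply: le_trans h1; rewrite lef_pV2 ?posrE// ler_nat.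
  by apply: le_trans h2 _; rewrite ler_nat.
- by move=> i; exact: measurable_itv.
- move=> i; apply/measurable_EFinP.
  by apply: measurable_funS (measurable_gamma_integrand a) => //; exact: J_sub.
- by move=> i x _; rewrite lee_fin gamma_integrand_ge0.
Qed.

Let is_derive_primitive (a x : R) : (0 < x)%R ->
  is_derive x 1%R (gamma_integrand (a + 1))
    (a * gamma_integrand a x - gamma_integrand (a + 1) x)%R.
Proof.
move=> x0; rewrite /gamma_integrand addrK.
have h := is_derive1_powR a x0.
have h2 : is_derive x 1%R (fun s : R => expR (- s)%R) (- expR (- x))%R.
  apply: is_derive_eq; by rewrite mulrN1.
apply: is_derive_eq.
rewrite /GRing.scale/=; ring.
Qed.

Let mJ n : measurable (J n : set (measurableTypeR R)).
Proof. exact: measurable_itv. Qed.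

Let itvJ n (x : R) : (n.+2%:R^-1 <= x <= n.+2%:R)%R -> (0 < x)%R.
Proof. by move=> h; have := @J_sub n x; rewrite /J/= !in_itv/= andbT; apply. Qed.

(** Integration by parts on each [J n]; the boundary values of s^a e^(-s) tend to 0 at both ends. *)
Lemma egammaS (a : R) : (0 < a)%R -> a%:E * egamma a = egamma (a + 1)%R.
Proof.
move=> a0.
have step n : a%:E * \int[mu]_(x in J n) (gamma_integrand a x)%:E =
    \int[mu]_(x in J n) (gamma_integrand (a + 1) x)%:E +
    (gamma_integrand (a + 1) n.+2%:R - gamma_integrand (a + 1) n.+2%:R^-1)%:E.
  have ltJ : (n.+2%:R^-1 < n.+2%:R :> R)%R.
    by apply: (@lt_le_trans _ _ 1%R); rewrite ?invf_lt1// ?ltr1n// ler1n.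
  have iJ b : mu.-integrable (J n) (EFin \o gamma_integrand b).
    apply: continuous_compact_integrable; first exact: segment_compact.
    apply: continuous_in_subspaceT => x /[!inE]; rewrite /J/= in_itv/= => /itvJ.
    exact: continuous_gamma_integrand.
  have iaJ : mu.-integrable (J n) (EFin \o (fun x => a * gamma_integrand a x)%R).
    exact: (integrableZl (mJ n) a (iJ a)).
  have dG (x : R) : (n.+2%:R^-1 <= x <= n.+2%:R)%R ->
      is_derive x 1%R (gamma_integrand (a + 1))
        (a * gamma_integrand a x - gamma_integrand (a + 1) x)%R.
    by move=> /itvJ; exact: is_derive_primitive.
  have := FTC2_is_derive ltJ dG.
  rewrite -/(J n) EFinB => <-; last first.
    move=> x /itvJ x0; apply: continuousB; last exact: continuous_gamma_integrand.
    by apply: continuousM; [exact: cvg_cst|exact: continuous_gamma_integrand].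
  under [X in _ = _ + X]eq_integral do rewrite EFinB.
  rewrite (integralB_EFin (mJ n) iaJ (iJ _)).
  rewrite [RHS]addeC subeK; last first.
    exact: (integrable_fin_num (mJ n) (iJ _)).
  under [RHS]eq_integral do rewrite EFinM.
  by rewrite (integralZl (mJ n) (iJ a)).
have cl : (fun n => a%:E * \int[mu]_(x in J n) (gamma_integrand a x)%:E)
    @ \oo --> a%:E * egamma a.
  by apply: cvgeZl => //; exact: cvg_J.
have cV : (n.+2%:R^-1 : R)%R @[n --> \oo] --> (0 : R)%R.
  by have := @cvg_harmonic R; rewrite -cvg_shiftS.
(* At s = n + 2, s^a <= s^k because k > a, and e^(-s) <= (k + 1)! / s^(k + 1); the product is at
   most (k + 1)! / s. *)
have cp : gamma_integrand (a + 1) n.+2%:R @[n --> \oo] --> (0 : R)%R.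
  pose k := (Num.truncn a).+1.
  have c0 : (k.+1`!%:R * n.+2%:R^-1 : R)%R @[n --> \oo] --> (0 : R)%R.
    by rewrite -(mulr0 (k.+1`!%:R)); apply: cvgM; [exact: cvg_cst|exact: cV].
  apply: squeeze_cvgr (cvg_cst 0%R) c0; apply: nearW => n.
  rewrite gamma_integrand_ge0/= /gamma_integrand addrK.
  have p1 : (n.+2%:R `^ a <= n.+2%:R ^+ k :> R)%R.
    by rewrite -powR_mulrn// ler_powR ?ler1n// ltW// truncnS_gt.
  have p2 : (expR (- n.+2%:R) <= k.+1`!%:R / n.+2%:R ^+ k.+1 :> R)%R.
    have pf : (0 < k.+1`!%:R / n.+2%:R ^+ k.+1 :> R)%R.
      by apply: divr_gt0; rewrite ?exprn_gt0// ltr0n fact_gt0.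
    rewrite expRN -[leRHS]invrK lef_pV2 ?posrE ?expR_gt0 ?invr_gt0//.
    rewrite invf_div; apply: le_trans (expR_ge1Dxn k _) => //.
    by rewrite lerDr.
  apply: le_trans (ler_pM (powR_ge0 _ _) (expR_ge0 _) p1 p2) _.
  rewrite (exprS _ k) invfM mulrCA ler_wpM2l// mulrCA divff ?mulr1//.
have cm : gamma_integrand (a + 1) n.+2%:R^-1 @[n --> \oo] --> (0 : R)%R.
  have c0 : ((n.+2%:R^-1 : R) `^ a)%R @[n --> \oo] --> (0 : R)%R.
    move/cvg_at_rightP : (powR_cvg0 a0); apply; split => // n.
  apply: squeeze_cvgr (cvg_cst 0%R) c0; apply: nearW => n.
  rewrite gamma_integrand_ge0/= /gamma_integrand addrK.
  by rewrite ler_piMr ?powR_ge0// expR_le1 oppr_le0.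
have cr : (fun n => \int[mu]_(x in J n) (gamma_integrand (a + 1) x)%:E +
    (gamma_integrand (a + 1) n.+2%:R - gamma_integrand (a + 1) n.+2%:R^-1)%:E)
    @ \oo --> egamma (a + 1)%R.
  rewrite -[X in _ --> X]adde0; apply: cvgeD; [exact: fin_num_adde_defl|exact: cvg_J|].
  by apply: cvg_EFin; [exact: nearW|rewrite -[0%R]subr0; exact: cvgB].
rewrite (funext step) in cl.
exact: cvg_unique cl cr.
Qed.

Lemma egamma1 : egamma 1 = 1.
Proof.
have e x : gamma_integrand 1 x = expR (- x).
  by rewrite /gamma_integrand subrr powRr0 mul1r.
rewrite /egamma; under eq_integral do rewrite e.
rewrite integral_itv_obnd_cbnd; last first.
  apply/measurable_EFinP; apply: measurable_funTS.
  by apply: continuous_measurable_fun => x; apply: continuous_comp; [exact: continuousN|exact: continuous_expR].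
have cE : continuous (fun x : R => expR (- x)).
  by move=> x; apply: continuous_comp; [exact: continuousN|exact: continuous_expR].
have dE (x : R) : is_derive x 1%R (fun s : R => - expR (- s))%R (expR (- x))%R.
  by apply: is_derive_eq; rewrite mulrN1 opprK.
rewrite (@ge0_continuous_FTC2y _ _ (fun s : R => - expR (- s))%R _ 0%R).
- by rewrite oppr0 expR0 EFinN oppeK add0e.
- by move=> x _; exact: expR_ge0.
- by apply: continuous_subspaceT.
- by rewrite -oppr0; apply: cvgN; exact: cvgr_expR.
- by move=> x _; have [] := dE x.
- apply: cvg_at_right_filter; apply: cvgN; exact: cE.
- by move=> x _; have [_ <-] := dE x; rewrite derive1E.
Qed.

Lemma egamma_le (a b c d e : R) : (0 <= c)%R -> (0 <= e)%R ->
  (forall s, 0 < s -> s `^ (a - 1) <= c * s `^ (b - 1) + e * s `^ (d - 1))%R ->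
  egamma a <= c%:E * egamma b + e%:E * egamma d.
Proof.
move=> c0 e0 H.
have mg r : measurable_fun (`]0%R, +oo[ : set R) (fun s => (gamma_integrand r s)%:E).
  apply/measurable_EFinP. exact: measurable_gamma_integrand.
have g0 r s : `]0%R, +oo[%classic s -> 0 <= (gamma_integrand r s)%:E.
  by move=> _; rewrite lee_fin gamma_integrand_ge0.
have D0 : measurable (`]0%R, +oo[%classic : set (measurableTypeR R)).
  exact: measurable_itv.
rewrite /egamma -(ge0_integralZl_EFin mu D0 (g0 b) (mg b) c0).
rewrite -(ge0_integralZl_EFin mu D0 (g0 d) (mg d) e0).
rewrite -ge0_integralD//; first last.
- by apply: measurable_funeM; exact: mg.
- by move=> x _; rewrite mule_ge0// lee_fin gamma_integrand_ge0.
- by apply: measurable_funeM; exact: mg.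
- by move=> x _; rewrite mule_ge0// lee_fin gamma_integrand_ge0.
apply: ge0_le_integral => //.
- by move=> x _; rewrite lee_fin gamma_integrand_ge0.
- exact: mg.

- apply: emeasurable_funD; apply: measurable_funeM; exact: mg.
- move=> x; rewrite /= in_itv/= andbT => x0.
  rewrite -!EFinM -EFinD lee_fin /gamma_integrand !mulrA -mulrDl.
  by rewrite ler_wpM2r ?expR_ge0// H.
Qed.

End GammaFun.

(** * Passage between Lebesgue measure on the Borel sets and its completion *)

Section CompletedIntegral.
Context {R : realType}.
Notation mu := (@lebesgue_measure R).
Notation leb := (leb_measure R).
Local Open Scope ereal_scope.

Lemma measurable_leb (D : set R) :
  measurable (D : set (measurableTypeR R)) -> measurable (D : set (leb_type R)).
Proof. exact: sub_caratheodory. Qed.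

Lemma measurable_id_leb :
  measurable_fun setT (idfun : leb_type R -> measurableTypeR R).
Proof. by move=> _ A mA; rewrite setTI; exact: measurable_leb. Qed.

Lemma measurable_fun_leb d (U : measurableType d) (D : set R) (g : R -> U) :
  measurable (D : set (measurableTypeR R)) ->
  measurable_fun (D : set (measurableTypeR R)) g ->
  measurable_fun (D : set (leb_type R)) (g : leb_type R -> U).
Proof.
by move=> mD mg mD' A mA; apply: measurable_leb; exact: mg.
Qed.

Lemma leb_itv (i : interval R) :
  leb [set` i] = if i.1 < i.2 then i.2 - i.1 else 0.
Proof. exact: lebesgue_measure_itv. Qed.

(** The Borel measure is the image of the completed one under the identity. Integrals in the
    completed sense can thus be computed by the fundamental theorem of calculus. *)
Lemma ge0_integral_leb (D : set R) (g : R -> \bar R) :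
  measurable (D : set (measurableTypeR R)) ->
  measurable_fun (D : set (measurableTypeR R)) g ->
  (forall x, D x -> 0 <= g x) ->
  \int[leb]_(x in (D : set (leb_type R))) g x = \int[mu]_(x in D) g x.
Proof.
move=> mD mg g0.
transitivity (\int[pushforward leb (idfun : leb_type R -> measurableTypeR R)]_(x in D) g x).
  rewrite (ge0_integral_pushforward measurable_id_leb leb mD mg)//.
  by move=> y /set_mem /g0.
apply: eq_measure_integral; first exact: measurable_id_leb.
by move=> A mA _; rewrite /= /pushforward.
Qed.

Lemma measurable_itv_leb (i : interval R) :
  measurable ([set` i] : set (leb_type R)).
Proof. apply: measurable_leb; exact: measurable_itv. Qed.

End CompletedIntegral.

Section Gamma.
Context {R : realType}.
Implicit Types (a b : R).

Lemma GammaE a : Gamma a = fine (egamma a).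
Proof.
rewrite /Gamma /Rintegral; congr fine; apply: ge0_integral_leb.
- exact: measurable_itv.
- apply/measurable_EFinP; exact: measurable_gamma_integrand.
- by move=> x _; rewrite lee_fin gamma_integrand_ge0.
Qed.

Lemma egamma_ge0 a : (0 <= egamma a)%E.
Proof. by apply: integral_ge0 => x _; rewrite lee_fin gamma_integrand_ge0. Qed.

(** For 0 < b < 1, integrating s^b <= 1 - b + b s bounds b Gamma(b) = Gamma(b + 1) by (1 - b)
    Gamma(1) + b Gamma(2), which is finite. The functional equation carries finiteness to larger
    arguments. *)
Lemma egamma_fin_num a : 0 < a -> egamma a \is a fin_num.
Proof.
have base b : 0 < b < 1 -> egamma b \is a fin_num.
  move=> b01; have /andP[b0 b1] := b01.
  have : (b%:E * egamma b < +oo)%E.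
    rewrite egammaS//.
    apply: le_lt_trans (_ : _ <= (1 - b)%:E * egamma 1 + b%:E * egamma (1 + 1))%E _.
      apply: egamma_le; [lra|lra|] => s s0.
      rewrite addrK subrr addrK powRr0 (powRr1 (ltW s0)) mulr1.
      by apply: powR_le_affine => //; exact: ltW.
    by rewrite -egammaS// egamma1 !mule1 -EFinD ltry.
  rewrite ge0_fin_numE ?egamma_ge0//.
  have := egamma_ge0 b; case: (egamma b) => [r _ _|_|//]; first by rewrite ltry.
  by rewrite gt0_muley// ltxx.
have unit b : 0 < b <= 1 -> egamma b \is a fin_num.
  move=> /andP[b0]; rewrite le_eqVlt => /predU1P[->|b1]; first by rewrite egamma1.
  by apply: base; rewrite b0.
have nat_shift b k : 0 < b <= 1 -> egamma (b + k%:R) \is a fin_num.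
  move=> b01; have /andP[b0 _] := b01.
  elim: k => [|k IH]; first by rewrite addr0 unit.
  by rewrite -natr1 addrA -egammaS ?ltr_wpDr// fin_numM.
move=> a0; have [a1|a1] := leP a 1; first by apply: unit; rewrite a0.
pose k := Num.truncn a.
have /andP[ka ak] : k%:R <= a < k.+1%:R by apply: truncn_itv; exact: ltW.
have k1 : (0 < k)%N by rewrite /k truncn_gt0 ltW.
have := ka; rewrite le_eqVlt => /predU1P[<-|{}ka].
  by rewrite -(prednK k1) -nat1r; apply: nat_shift; rewrite ltr01 lexx.
rewrite -(subrK k%:R a); apply: nat_shift.
by rewrite subr_gt0 ka/= lerBlDr nat1r ltW.
Qed.

Lemma egammaEFin a : 0 < a -> egamma a = (Gamma a)%:E.
Proof. by move=> a0; rewrite GammaE fineK// egamma_fin_num. Qed.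

Lemma GammaS a : 0 < a -> Gamma (a + 1) = a * Gamma a.
Proof.
move=> a0; apply: EFin_inj; rewrite EFinM -!egammaEFin ?egammaS//.
by rewrite addr_gt0.
Qed.

Lemma Gamma1 : Gamma 1 = 1 :> R.
Proof. by rewrite GammaE egamma1. Qed.

Lemma Gamma_nat k : Gamma k.+1%:R = k`!%:R :> R.
Proof.
elim: k => [|k IH]; first by rewrite Gamma1 fact0.
by rewrite -natr1 GammaS ?ltr0n// IH factS natrM.
Qed.

(* Log-convexity of Gamma, obtained by integrating the weighted AM-GM
   inequality [s ^ a <= b ^ a ((1 - a) + a (s / b))]. *)
Lemma Gamma_le_powR a b : 0 < a < 1 -> 0 < b ->
  Gamma (b + a) <= b `^ a * Gamma b.
Proof.
move=> a01 b0; have /andP[a0 a1] := a01.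
have H : (egamma (b + a) <= (b `^ a * (1 - a))%:E * egamma b +
    (b `^ a * a / b)%:E * egamma (b + 1))%E.
  apply: egamma_le.
  - by rewrite mulr_ge0 ?powR_ge0// subr_ge0 ltW.
  - by rewrite divr_ge0 ?mulr_ge0 ?powR_ge0// ltW.
  - move=> s s0; have sn0 : s != 0 by rewrite gt_eqF.
    rewrite addrK (addrAC b a) (@powRD _ s (b - 1) a) ?sn0 ?implybT//.
    have -> : s `^ b = s `^ (b - 1) * s.
      by rewrite -[s in X in _ = _ * X]powRr1 ?ltW// -powRD ?subrK// sn0 implybT.
    have -> : s `^ a = b `^ a * (s / b) `^ a.
      by rewrite -powRM ?divr_ge0 ?ltW// mulrCA divff ?mulr1// gt_eqF.
    have -> : b `^ a * (1 - a) * s `^ (b - 1) + b `^ a * a / b * (s `^ (b - 1) * s)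
        = s `^ (b - 1) * (b `^ a * ((1 - a) + a * (s / b))) by ring.
    rewrite ler_wpM2l ?powR_ge0// ler_wpM2l ?powR_ge0// powR_le_affine//.
    by rewrite divr_ge0 ?ltW.
move: H; rewrite !egammaEFin ?addr_gt0// -!EFinM -EFinD lee_fin => /le_trans; apply.
rewrite GammaS// le_eqVlt; apply/orP; left; apply/eqP; field.
by rewrite gt_eqF.
Qed.

(** Log-convexity gives 1 = Gamma(a + (1 - a)) <= a^(1 - a) Gamma(a). *)
Lemma Gamma_gt0 a : 0 < a < 1 -> 0 < Gamma a.
Proof.
move=> /andP[a0 a1].
have H : (1 <= a `^ (1 - a) * Gamma a :> R).
  have a01' : 0 < 1 - a < 1 by lra.
  have := Gamma_le_powR a01' a0.
  by rewrite (_ : a + (1 - a) = 1) ?Gamma1//; ring.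
have G0 : 0 <= Gamma a by rewrite GammaE fine_ge0// egamma_ge0.
rewrite lt0r G0 andbT; apply: contraTN H => /eqP ->.
by rewrite mulr0 -ltNge.
Qed.

Lemma Gamma_acoef a k : 0 < a ->
  Gamma (k%:R + a) = acoef a k * k`!%:R * Gamma a.
Proof.
move=> a0; elim: k => [|k IH].
  by rewrite add0r acoef0 fact0 !mul1r.
rewrite -natr1 addrAC GammaS; last by rewrite ltr_wpDl.
rewrite IH factS natrM [acoef a k.+1 * _]mulrA [acoef a k.+1 * _]mulrC.
by rewrite acoefS_mul; ring.
Qed.

(** Log-convexity from k + 1 to k + 1 + a: Gamma(k + 1 + a) <= (k + 1)^a k!, divided by (k + 1)!. *)
Lemma Gamma_acoef_le a k : 0 < a < 1 ->
  Gamma a * acoef a k.+1 <= k.+1%:R `^ (a - 1).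
Proof.
move=> a01; have /andP[a0 a1] := a01.
have k0 : 0 < k.+1%:R :> R by rewrite ltr0n.
have := Gamma_le_powR a01 k0; rewrite Gamma_acoef// Gamma_nat factS natrM.
have kf : 0 < k`!%:R :> R by rewrite ltr0n fact_gt0.
rewrite powRB ?(gt_eqF k0) ?implybT// (powRr1 (ltW k0)) ler_pdivlMr// => H.
rewrite -(ler_pM2r kf); apply: le_trans H.
by rewrite le_eqVlt; apply/orP; left; apply/eqP; ring.
Qed.

(** Log-convexity from k + a to k + 1: k! <= (k + a)^(1 - a) Gamma(k + a); then k + a is replaced by
    k + 1. *)
Lemma Gamma_acoef_ge a k : 0 < a < 1 ->
  k.+1%:R `^ (a - 1) <= Gamma a * acoef a k.
Proof.
move=> a01; have /andP[a0 a1] := a01.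
have b0 : 0 < k%:R + a by rewrite ltr_wpDl.
have a01' : 0 < 1 - a < 1 by lra.
have := Gamma_le_powR a01' b0.
have -> : k%:R + a + (1 - a) = k.+1%:R by rewrite -natr1; ring.
rewrite Gamma_nat Gamma_acoef// => H.
have kf : 0 < k`!%:R :> R by rewrite ltr0n fact_gt0.
apply: (@le_trans _ _ ((k%:R + a) `^ (a - 1))).
  apply: powR_gt0_le_inv => //; last by rewrite subr_le0 ltW.
  by rewrite -natr1 lerD2l ltW.
rewrite -opprB powRN -[leLHS]mul1r ler_pdivrMr ?powR_gt0//.
rewrite -(ler_pM2r kf) mul1r; apply: le_trans H _.
by rewrite le_eqVlt; apply/orP; left; apply/eqP; ring.
Qed.

End Gamma.

(** * The discrete kernel *)

Section Kernel.
Context {R : realType}.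
Implicit Types (a h s x y lam : R).

Lemma powR_half_le x y a : 0 < a < 1 -> 0 < y -> y <= 2 * x ->
  x `^ (a - 1) <= 2 * y `^ (a - 1).
Proof.
move=> /andP[a0 a1] y0 yx.
have y20 : 0 < y / 2 by rewrite divr_gt0.
apply: (@le_trans _ _ ((y / 2) `^ (a - 1))).
  apply: powR_gt0_le_inv => //; last by rewrite subr_le0 ltW.
  by rewrite ler_pdivrMr// mulrC.
rewrite powRM ?invr_ge0 ?(ltW y0)// mulrC ler_wpM2r ?powR_ge0//.
rewrite -[X in X `^ _]powR_inv1// -powRrM mulN1r opprB.
by apply: ler1_powR; rewrite ?ler1n// lerBlDr lerDl ltW.
Qed.

(** [1 + Gamma a] is for the cell at the singularity, 2 for all the others; the sum covers both. *)
Definition kernel_cst a := 2 + Gamma a.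

Lemma kernel_cst_gt0 a : 0 < a < 1 -> 0 < kernel_cst a.
Proof. by move=> a01; rewrite addr_gt0// Gamma_gt0. Qed.

(* The exponent a / 2, instead of the optimal rate, is what makes the right-hand
   side integrable in s while keeping a positive power of h. *)
Lemma kernel_bound a h s (k : nat) : 0 < a < 1 -> 0 < h -> 0 < s ->
  k%:R * h <= s < k.+1%:R * h ->
  `|s `^ (a - 1) - Gamma a * (h `^ (a - 1) * acoef a k)| <=
    kernel_cst a * h `^ (a / 2) * s `^ (a / 2 - 1).
Proof.
move=> a01 h0 s0 /andP[ks sk].
have /andP[a0 a1] := a01; have G0 := Gamma_gt0 a01.
have a21 : 0 < a / 2 < 1 by lra.
have am1 : a - 1 <= 0 by lra.
have split_s : s `^ (a / 2 - 1) * s `^ (a / 2) = s `^ (a - 1).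
  by rewrite -powRD ?(gt_eqF s0) ?implybT//; congr (_ `^ _); field.
(* On the first cell nothing cancels: both terms are at most multiples of s^(a - 1), and s < h
   trades s^(a/2) for h^(a/2). *)
case: k ks sk => [_|k ks sk].
  rewrite mul1r => sh; rewrite acoef0 mulr1.
  have hs : h `^ (a - 1) <= s `^ (a - 1).
    by apply: powR_gt0_le_inv => //; exact: ltW.
  apply: (@le_trans _ _ ((1 + Gamma a) * s `^ (a - 1))).
    apply: le_trans (ler_normB _ _) _.
    rewrite !ger0_norm ?powR_ge0//; last by rewrite mulr_ge0 ?powR_ge0// ltW.
    by rewrite mulrDl mul1r lerD2l ler_wpM2l// ltW.
  rewrite -split_s mulrA -mulrA [X in _ * X]mulrC mulrA.
  rewrite ler_wpM2r ?powR_ge0// /kernel_cst.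
  apply: ler_pM; rewrite ?powR_ge0//; [lra|lra|].
  by apply: ge0_ler_powR; rewrite ?nnegrE; lra.
have k0 : 0 < k.+1%:R :> R by rewrite ltr0n.
(* With p and q the ends of the cell, both quantities lie between q^(a - 1) and p^(a - 1), a gap of
   at most p^(a - 1) h / q because (q/p)^(a - 1) >= p/q. As h <= p <= s < 2 p, also h/s <=
   (h/s)^(a/2) and p^(a - 1) <= 2 s^(a - 1). *)
set p := k.+1%:R * h in ks; set q := k.+2%:R * h in sk.
have p0 : 0 < p by rewrite mulr_gt0.
have qE : q = p + h by rewrite /q /p -(natr1 k.+1) mulrDl mul1r.
have hp : h <= p by rewrite -[leLHS]mul1r ler_pM2r// ler1n.
have up1 : s `^ (a - 1) <= p `^ (a - 1) by apply: powR_gt0_le_inv.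
have lo1 : q `^ (a - 1) <= s `^ (a - 1) by apply: powR_gt0_le_inv => //; exact: ltW.
have up2 : Gamma a * (h `^ (a - 1) * acoef a k.+1) <= p `^ (a - 1).
  rewrite mulrCA /p (mulrC k.+1%:R h) powRM ?(ltW h0) ?(ltW k0)//.
  by rewrite ler_wpM2l ?powR_ge0// Gamma_acoef_le.
have lo2 : q `^ (a - 1) <= Gamma a * (h `^ (a - 1) * acoef a k.+1).
  rewrite mulrCA /q (mulrC k.+2%:R h) powRM ?(ltW h0)//.
  by rewrite ler_wpM2l ?powR_ge0// Gamma_acoef_ge.
apply: (@le_trans _ _ (p `^ (a - 1) - q `^ (a - 1))).
  by rewrite ler_norml; apply/andP; split; lra.
have q0 : 0 < q by lra.
have pq : p `^ (a - 1) * (p / q) <= q `^ (a - 1).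
  have -> : q `^ (a - 1) = p `^ (a - 1) * (q / p) `^ (a - 1).
    by rewrite -powRM ?divr_ge0 ?(ltW p0) ?(ltW q0)// mulrCA divff ?mulr1// gt_eqF.
  rewrite ler_wpM2l ?powR_ge0// -[p / q]invf_div -(@powR_inv1 _ (q / p)) ?divr_ge0 ?(ltW p0) ?(ltW q0)//.
  apply: ler_powR; last by lra.
  by rewrite ler_pdivlMr// mul1r qE lerDl ltW.
apply: (@le_trans _ _ (p `^ (a - 1) * (h / s))).
  apply: (@le_trans _ _ (p `^ (a - 1) * (h / q))).
    have -> : h / q = 1 - p / q by rewrite qE; field; lra.
    by rewrite mulrBr mulr1 lerD2l lerN2.
  by rewrite ler_wpM2l ?powR_ge0// ler_pM2l// lef_pV2 ?posrE// ltW.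
have hs1 : 0 < h / s <= 1.
  by rewrite divr_gt0//= ler_pdivrMr// mul1r (le_trans hp).
have hs2 : h / s <= (h / s) `^ (a / 2) by apply: ger1_powR => //; lra.
have ps : p `^ (a - 1) <= 2 * s `^ (a - 1) by apply: powR_half_le => //; lra.
have hs0 : 0 <= h / s by lra.
apply: le_trans (ler_pM (powR_ge0 _ _) hs0 ps hs2) _.
rewrite powRM ?invr_ge0 ?(ltW h0) ?(ltW s0)// -split_s.
have -> : s^-1 `^ (a / 2) = (s `^ (a / 2))^-1.
  by rewrite -powR_inv1 ?(ltW s0)// -powRrM mulN1r powRN.
have -> : 2 * (s `^ (a / 2 - 1) * s `^ (a / 2)) * (h `^ (a / 2) / s `^ (a / 2)) =
    2 * (h `^ (a / 2) * s `^ (a / 2 - 1)).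
  by field; rewrite gt_eqF// powR_gt0.
by rewrite -mulrA ler_wpM2r ?mulr_ge0 ?powR_ge0// /kernel_cst lerDl ltW.
Qed.

(** 1 is for k = 0; for k > 0 the 2 pays for passing from k^(a - 1) to (k + 1)^(a - 1). *)
Definition acoef_cst a := 1 + 2 / Gamma a.

Lemma acoef_cst_gt0 a : 0 < a < 1 -> 0 < acoef_cst a.
Proof. by move=> a01; rewrite addr_gt0// divr_gt0// Gamma_gt0. Qed.

Lemma acoef_le a k : 0 < a < 1 ->
  acoef a k <= acoef_cst a * k.+1%:R `^ (a - 1).
Proof.
move=> a01; have /andP[a0 a1] := a01; have G0 := Gamma_gt0 a01.
case: k => [|k].
  by rewrite acoef0 powR1 mulr1 lerDl divr_ge0 ?(ltW G0).
rewrite -(ler_pM2l G0); apply: le_trans (Gamma_acoef_le _ a01) _.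
have h : k.+1%:R `^ (a - 1) <= 2 * k.+2%:R `^ (a - 1) :> R.
  apply: powR_half_le => //.
  by rewrite -natrM ler_nat mul2n -addnn !addSn addnS !ltnS leq_addr.
apply: le_trans h _; rewrite mulrA ler_wpM2r ?powR_ge0//.
by rewrite /acoef_cst mulrDr mulr1 mulrCA divff ?mulr1 ?gt_eqF// lerDr ltW.
Qed.

Lemma sum_acoef_le a h P : 0 < a < 1 -> 0 < h ->
  \sum_(k < P) h `^ a * acoef a k <= acoef_cst a / a * (P%:R * h) `^ a.
Proof.
move=> a01 h0; have /andP[a0 a1] := a01; have C0 := acoef_cst_gt0 a01.
rewrite -mulr_sumr powRM ?(ltW h0)// [leRHS]mulrC -mulrA mulrCA.
rewrite ler_wpM2l ?powR_ge0// mulrCA.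
apply: (@le_trans _ _ (\sum_(k < P) acoef_cst a * k.+1%:R `^ (a - 1))).
  by apply: ler_sum => k _; exact: acoef_le.
by rewrite -mulr_sumr ler_wpM2l ?(ltW C0)// sum_powR_le.
Qed.

Lemma expRN_le_powR x b : 0 < x -> 0 < b < 1 -> expR (- x) <= x `^ (- b).
Proof.
move=> x0 b01; rewrite expRN powRN lef_pV2 ?posrE ?expR_gt0 ?powR_gt0//.
apply: le_trans (powR_le_affine (ltW x0) b01) _.
apply: le_trans (expR_ge1Dx _).
have /andP[b0 b1] := b01.
have : b * x <= x by rewrite ger_pMl// ltW.
lra.
Qed.

(** Exponential decay is traded for a power, e^(-x) <= x^(-a/2) at x = lam (k + 1) h: the kernel
    s^(a/2 - 1) stays summable and lam^(-a/2) comes out as a small factor. Shifting k to k + 1,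
    which avoids x = 0, costs [expR (lam * h)]. *)
Lemma sum_acoef_expR_le a h lam P : 0 < a < 1 -> 0 < h -> 0 < lam ->
  \sum_(k < P) h `^ a * acoef a k * expR (- (lam * (k%:R * h))) <=
  acoef_cst a * expR (lam * h) * lam `^ (- (a / 2)) / (a / 2) *
    (P%:R * h) `^ (a / 2).
Proof.
move=> a01 h0 l0; have /andP[a0 a1] := a01; have C0 := acoef_cst_gt0 a01.
have b01 : 0 < a / 2 < 1 by lra.
apply: (@le_trans _ _ (\sum_(k < P) acoef_cst a * expR (lam * h) *
    lam `^ (- (a / 2)) * h `^ (a / 2) * k.+1%:R `^ (a / 2 - 1))); last first.
  rewrite -mulr_sumr (powRM _ _ (ltW h0))//.
  rewrite [leRHS](_ : _ = acoef_cst a * expR (lam * h) * lam `^ (- (a / 2)) *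
    h `^ (a / 2) * (P%:R `^ (a / 2) / (a / 2))); last by ring.
  rewrite ler_wpM2l ?sum_powR_le//.
  by rewrite !mulr_ge0 ?expR_ge0 ?powR_ge0// ltW.
apply: ler_sum => k _.
have k0 : 0 < k.+1%:R :> R by rewrite ltr0n.
have -> : expR (- (lam * (k%:R * h))) =
    expR (lam * h) * expR (- (lam * (k.+1%:R * h))).
  by rewrite -expRD -natr1; congr expR; ring.
have := expRN_le_powR (mulr_gt0 l0 (mulr_gt0 k0 h0)) b01.
rewrite !powRM ?mulr_ge0 ?(ltW l0) ?(ltW k0) ?(ltW h0)// => He.
have Ha := acoef_le k a01.
have E0 := expR_gt0 (lam * h).
have ha0 := powR_gt0 a h0.
have -> : acoef_cst a * expR (lam * h) * lam `^ (- (a / 2)) * h `^ (a / 2) *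
    k.+1%:R `^ (a / 2 - 1) =
  h `^ a * (acoef_cst a * k.+1%:R `^ (a - 1)) * (expR (lam * h) *
   (lam `^ (- (a / 2)) * (k.+1%:R `^ (- (a / 2)) * h `^ (- (a / 2))))).
  have -> : h `^ (a / 2) = h `^ a * h `^ (- (a / 2)).
    by rewrite -powRD ?(gt_eqF h0) ?implybT//; congr (_ `^ _); field.
  have -> : k.+1%:R `^ (a / 2 - 1) = k.+1%:R `^ (a - 1) * k.+1%:R `^ (- (a / 2)) :> R.
    by rewrite -powRD ?(gt_eqF k0) ?implybT//; congr (_ `^ _); field.
  by ring.
apply: ler_pM.
- by rewrite mulr_ge0 ?powR_ge0// ltW// acoef_gt0.
- by rewrite mulr_ge0 ?expR_ge0.
- by rewrite ler_wpM2l ?powR_ge0.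
- by rewrite ler_wpM2l ?expR_ge0.
Qed.

(** The doubling bound applies because i + 1 <= 2 (i + 1/2). Midpoints are the points where
    [fdiff_refine] compares kernels. *)
Lemma sum_midpoint_powR_le b h P : 0 < b < 1 -> 0 < h ->
  \sum_(i < P) h * ((i%:R + 2^-1) * h) `^ (b - 1) <= 2 / b * (P%:R * h) `^ b.
Proof.
move=> b01 h0; have /andP[b0 b1] := b01.
rewrite powRM ?(ltW h0)//.
apply: (@le_trans _ _ (\sum_(i < P) 2 * h `^ b * i.+1%:R `^ (b - 1))).
  apply: ler_sum => i _.
  have i0 : 0 <= i%:R + 2^-1 :> R by rewrite addr_ge0.
  rewrite powRM ?(ltW h0)// mulrCA (mulr_powRB1 (ltW h0) b0).
  rewrite mulrC -mulrA [leRHS]mulrCA ler_wpM2l ?powR_ge0//.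
  apply: powR_half_le => //.
  by rewrite -natr1 mulrDr divff// lerD2r ler_peMl ?ler1n.
rewrite -mulr_sumr.
rewrite [leRHS](_ : _ = 2 * h `^ b * (P%:R `^ b / b)); last by ring.
by rewrite ler_wpM2l ?sum_powR_le// mulr_ge0 ?powR_ge0.
Qed.

End Kernel.

(** * Fractional differences *)

Section Fdiff.
Context {R : realType} {V : lmodType R}.
Implicit Types (a h t : R) (G : R -> V).

(* The approximation of the derivative of order 1 - a truncated after [P] terms:
   when [G] vanishes on the negative reals, its value does not depend on [P] as
   soon as t < P h. *)
Definition fdiff a h (P : nat) G t : V :=
  h `^ (a - 1) *: \sum_(j < P) acoef (a - 1) j *: G (t - j%:R * h).

Definition zero_ext G (s : R) : V := if s < 0 then 0 else G s.

Lemma zero_ext_lt0 G s : s < 0 -> zero_ext G s = 0.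
Proof. by rewrite /zero_ext => ->. Qed.

Lemma zero_ext_ge0 G s : 0 <= s -> zero_ext G s = G s.
Proof. by rewrite /zero_ext leNgt => /negbTE ->. Qed.

Lemma fdiffB a h P G1 G2 t :
  fdiff a h P (fun s => G1 s - G2 s) t = fdiff a h P G1 t - fdiff a h P G2 t.
Proof.
rewrite /fdiff -scalerBr -sumrB; congr (_ *: _); apply: eq_bigr => j _.
by rewrite scalerBr.
Qed.

Lemma eq_fdiff a h P G1 G2 t : 0 < h ->
  (forall s, s <= t -> G1 s = G2 s) -> fdiff a h P G1 t = fdiff a h P G2 t.
Proof.
move=> h0 e; rewrite /fdiff; congr (_ *: _); apply: eq_bigr => j _.
by rewrite e// lerBlDr lerDl mulr_ge0// ltW.
Qed.

Lemma fdiff_abel a h P G t : G (t - P%:R * h) = 0 ->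
  fdiff a h P G t = \sum_(k < P) (h `^ (a - 1) * acoef a k) *:
    (G (t - k%:R * h) - G (t - k.+1%:R * h)).
Proof.
move=> GP; rewrite /fdiff (@abel_sum _ _ _ (fun j => G (t - j%:R * h)))//.
by rewrite scaler_sumr; apply: eq_bigr => k _; rewrite scalerA subrK.
Qed.

End Fdiff.

Section FdiffVector.
Context {R : realType} {n : nat}.
Implicit Types (a h t : R) (G : R -> 'rV[R]_n).

(** The terms beyond the integer part of t / h are killed by the zero extension, so one number of
    terms serves for all t. *)
Lemma frac_diff_fdiff a h P G t : 0 < h -> 0 <= t -> t < P%:R * h ->
  h `^ (a - 1) *: frac_diff h (1 - a) G t = fdiff a h P (zero_ext G) t.
Proof.
move=> h0 t0 tP; rewrite /fdiff /frac_diff; congr (_ *: _).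
set N := Num.truncn (t / h).
have th0 : 0 <= t / h by rewrite divr_ge0 ?(ltW h0).
have /andP[Nt tN] : N%:R <= t / h < N.+1%:R by exact: truncn_itv.
have NP : (N < P)%N.
  by rewrite -(ltr_nat R); apply: le_lt_trans Nt _; rewrite ltr_pdivrMr.
rewrite -(big_mkord xpredT (fun j =>
  ((-1) ^+ j * gbinom (1 - a) j) *: G (t - j%:R * h))).
rewrite -(big_mkord xpredT (fun j =>
  acoef (a - 1) j *: zero_ext G (t - j%:R * h))).
rewrite [RHS](@big_cat_nat _ _ _ N.+1)//=.
rewrite [X in _ = _ + X]big_nat_cond [X in _ = _ + X]big1 ?addr0; last first.
  move=> j /andP[/andP[Nj _] _]; rewrite zero_ext_lt0 ?scaler0//.
  rewrite subr_lt0 -ltr_pdivrMr//; apply: lt_le_trans tN _.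
  by rewrite ler_nat.
apply: eq_big_nat => j /andP[_ jN].
rewrite gbinom_acoef opprB zero_ext_ge0// subr_ge0 -ler_pdivlMr//.
by apply: le_trans Nt; rewrite ler_nat.
Qed.

Lemma fdiff_coord a h P G t i :
  fdiff a h P G t ord0 i = fdiff a h P (fun s => G s ord0 i : R^o) t.
Proof.
rewrite /fdiff mxE summxE; congr (_ * _); apply: eq_bigr => j _.
by rewrite mxE.
Qed.

Lemma enorm_fdiff_le a h P G t (b : nat -> R) : 0 < a -> 0 < h ->
  G (t - P%:R * h) = 0 ->
  (forall k, (k < P)%N ->
    enorm (G (t - k%:R * h) - G (t - k.+1%:R * h)) <= h * b k) ->
  enorm (fdiff a h P G t) <= \sum_(k < P) h `^ a * acoef a k * b k.
Proof.
move=> a0 h0 GP Gb; rewrite fdiff_abel//.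
apply: le_trans (enorm_sum _) _; apply: ler_sum => k _.
rewrite enormZ ger0_norm; last by rewrite mulr_ge0 ?powR_ge0// ltW// acoef_gt0.
have -> : h `^ a * acoef a k * b k = h `^ (a - 1) * acoef a k * (h * b k).
  by rewrite -(mulr_powRB1 (ltW h0) a0); ring.
apply: ler_wpM2l; first by rewrite mulr_ge0 ?powR_ge0// ltW// acoef_gt0.
exact: Gb.
Qed.

End FdiffVector.

Section FdiffScalar.
Context {R : realType}.
Implicit Types (a h t : R) (G : R -> R^o).

(** Grouping the pairs by m = k + j; those with k + j >= P contribute nothing. *)
Lemma sum_convolution (b c X : nat -> R) P :
  (forall m, (P <= m)%N -> X m = 0) ->
  \sum_(k < P) \sum_(j < P) b k * c j * X (k + j)%N =
  \sum_(m < P) (\sum_(k < m.+1) b k * c (m - k)%N) * X m.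
Proof.
move=> XP.
have XE k j : X (k + j)%N =
    \sum_(m < P) (if m == (k + j)%N :> nat then X m else 0).
  rewrite -big_mkcond/=; have [kjP|Pkj] := ltnP (k + j) P.
    by rewrite (big_pred1 (Ordinal kjP)).
  by rewrite XP// big_pred0// => m; rewrite ltn_eqF// (leq_trans (ltn_ord m)).
under eq_bigr => k _ do under eq_bigr => j _ do rewrite XE mulr_sumr.
under eq_bigr => k _ do rewrite exchange_big.
rewrite exchange_big/=; apply: eq_bigr => m _.
rewrite (big_ord_widen P (fun k => b k * c (m - k)%N) (ltn_ord m)).
rewrite mulr_suml [RHS]big_mkcond/=; apply: eq_bigr => k _.
have [km|mk] := ltnP k m.+1; last first.
  rewrite big1// => j _; case: eqP => [mE|]; last by rewrite mulr0.
  by move: mk; rewrite mE ltnNge leq_addr.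
have mkP : (m - k < P)%N by rewrite (leq_ltn_trans (leq_subr _ _)).
rewrite (bigD1 (Ordinal mkP))//= subnKC// eqxx big1 ?addr0// => j.
rewrite -val_eqE/= => jmk; case: eqP => [mE|]; last by rewrite mulr0.
by move: jmk; rewrite mE addKn eqxx.
Qed.

(** The powers of h cancel, and the convolved coefficients are those of (1 - z)^0, so only the term
    m = 0 survives. *)
Lemma fdiff_inverse a h P G t : 0 < h ->
  (forall s, s < 0 -> G s = 0) -> t < P%:R * h ->
  \sum_(k < P) h `^ (1 - a) * acoef (1 - a) k * fdiff a h P G (t - k%:R * h) = G t.
Proof.
move=> h0 G0 tP.
pose X m := G (t - m%:R * h).
have XP m : (P <= m)%N -> X m = 0.
  move=> Pm; apply: G0; rewrite subr_lt0; apply: lt_le_trans tP _.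
  by rewrite ler_pM2r// ler_nat.
transitivity (\sum_(k < P) \sum_(j < P) acoef (1 - a) k * acoef (a - 1) j * X (k + j)%N).
  apply: eq_bigr => k _; rewrite /fdiff /GRing.scale/= mulrACA -powRD; last first.
    by rewrite (gt_eqF h0) ?implybT.
  rewrite addrA subrK subrr powRr0 mul1r mulr_sumr; apply: eq_bigr => j _.
  by rewrite mulrA /X natrD mulrDl opprD addrA.
rewrite sum_convolution//.
have V m : \sum_(k < m.+1) acoef (1 - a) k * acoef (a - 1) (m - k) = (m == 0)%:R.
  rewrite acoef_vandermonde addrA subrK subrr.
  by case: m => [|m]; rewrite ?acoef0 ?acoef_0.
under eq_bigr => m _ do rewrite V.
case: P tP XP => [|P] tP XP.
  by rewrite big_ord0 G0//; move: tP; rewrite mul0r.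
rewrite big_ord_recl/= mul1r big1 ?addr0; first by rewrite /X mul0r subr0.
by move=> i _; rewrite mul0r.
Qed.

(** A weight constant on blocks of m fine cells sees only the telescoped increment of each block. *)
Lemma sum_blocks (b E : nat -> R) P m :
  \sum_(i < P * m) b (i %/ m)%N * (E i - E i.+1) =
  \sum_(k < P) b k * (E (k * m)%N - E (k.+1 * m)%N).
Proof.
have [->|m0] := posnP m.
  by rewrite muln0 big_ord0 big1// => k _; rewrite !muln0 subrr mulr0.
elim: P => [|P IH]; first by rewrite mul0n !big_ord0.
rewrite [RHS]big_ord_recr/= -IH.
rewrite -!(big_mkord xpredT (fun i => b (i %/ m)%N * (E i - E i.+1))).
rewrite (@big_cat_nat _ _ _ (P * m))//=; last by rewrite leq_mul2r leqnSn orbT.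
congr (_ + _); rewrite -opprB -(telescope_sumr E); last by rewrite leq_mul2r leqnSn orbT.
rewrite -sumrN mulr_sumr; apply: eq_big_nat => i /andP[i1 i2].
rewrite opprB; congr (b _ * _).
by apply/eqP; rewrite eqn_leq leq_divRL// i1 andbT -ltnS ltn_divLR.
Qed.

(** After Abel summation both operators are sums over the fine cells. Their weights are each
    compared with the kernel at the midpoint s of the fine cell, which lies in the coarse cell as
    well and is positive even for i = 0. The constant 4 is 2 for the two comparisons times 2 from
    the midpoint sum. *)
Lemma fdiff_refine a h P m G t (L : R) : 0 < a < 1 -> 0 < h -> (0 < m)%N ->
  (forall s, s <= t -> `|G s - G (s - h / m%:R)| <= L * (h / m%:R)) ->
  G (t - P%:R * h) = 0 ->
  `|fdiff a (h / m%:R) (P * m) G t - fdiff a h P G t| <=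
  kernel_cst a / Gamma a * h `^ (a / 2) * (4 / (a / 2) * (P%:R * h) `^ (a / 2)) * L.
Proof.
move=> a01 h0 m0 GL GP; have /andP[a0 a1] := a01.
have G0 := Gamma_gt0 a01; have C0 := kernel_cst_gt0 a01.
have mr0 : 0 < m%:R :> R by rewrite ltr0n.
set h' := h / m%:R.
have h'0 : 0 < h' by rewrite divr_gt0.
have hE : h = m%:R * h' by rewrite /h' mulrCA divff ?mulr1// gt_eqF.
pose E i := G (t - i%:R * h').
have Ek k : G (t - k%:R * h) = E (k * m)%N by rewrite /E natrM -mulrA -hE.
rewrite !fdiff_abel//; last by rewrite natrM -mulrA -hE.
rewrite /GRing.scale/=.
under [X in _ - X]eq_bigr => k _ do rewrite !Ek.
rewrite -(sum_blocks (fun k => h `^ (a - 1) * acoef a k)) -sumrB.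
apply: le_trans (ler_norm_sum _ _ _) _.
apply: (@le_trans _ _ (\sum_(i < P * m) 2 * (kernel_cst a / Gamma a) * h `^ (a / 2) *
    L * (h' * ((i%:R + 2^-1) * h') `^ (a / 2 - 1)))); last first.
  rewrite -mulr_sumr.
  have L0 : 0 <= L.
    have := GL t (lexx _); rewrite -/h' => /(le_trans (normr_ge0 _)).
    by rewrite pmulr_lge0.
  rewrite [leRHS](_ : _ = 2 * (kernel_cst a / Gamma a) * h `^ (a / 2) * L *
    (2 / (a / 2) * (P%:R * h) `^ (a / 2))); last by ring.
  rewrite ler_wpM2l//.
    by rewrite !mulr_ge0 ?powR_ge0 ?invr_ge0 ?(ltW C0) ?(ltW G0).
  have := @sum_midpoint_powR_le R (a / 2) h' (P * m).
  by rewrite natrM -(mulrA P%:R) -hE; apply => //; lra.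
apply: ler_sum => i _.
rewrite -/(E i) -/(E i.+1) -mulrBl normrM.
have dE : `|E i - E i.+1| <= L * h'.
  rewrite /E (_ : t - i.+1%:R * h' = t - i%:R * h' - h'); last by rewrite -(natr1 i); ring.
  by apply: GL; rewrite lerBlDr lerDl mulr_ge0// ltW.
pose s := (i%:R + 2^-1) * h'.
have s0 : 0 < s by rewrite mulr_gt0// ltr_wpDl.
have K1 : `|s `^ (a - 1) - Gamma a * (h' `^ (a - 1) * acoef a i)| <=
    kernel_cst a * h' `^ (a / 2) * s `^ (a / 2 - 1).
  apply: kernel_bound => //; rewrite /s ler_pM2r// ltr_pM2r// -(natr1 i). lra.
have K2 : `|s `^ (a - 1) - Gamma a * (h `^ (a - 1) * acoef a (i %/ m)%N)| <=
    kernel_cst a * h `^ (a / 2) * s `^ (a / 2 - 1).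
  have hM k : k%:R * h = (k * m)%:R * h' by rewrite natrM -mulrA -hE.
  apply: kernel_bound => //; rewrite !hM /s ler_pM2r// ltr_pM2r//.
  apply/andP; split.
    by apply: (@le_trans _ _ i%:R); rewrite ?ler_nat ?leq_trunc_div// lerDl.
  apply: (@lt_le_trans _ _ i.+1%:R); first by rewrite -(natr1 i); lra.
  by rewrite ler_nat -ltn_divLR.
have hh' : h' `^ (a / 2) <= h `^ (a / 2).
  apply: ge0_ler_powR; rewrite ?nnegrE; [lra|exact: ltW|exact: ltW|].
  by rewrite hE ler_peMl ?(ltW h'0)// ler1n.
set c1 := h' `^ (a - 1) * _ in K1 *; set c2 := h `^ (a - 1) * _ in K2 *.
set w := s `^ (a / 2 - 1) in K1 K2 *.
have w0 : 0 <= w by exact: powR_ge0.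
have cc : `|c1 - c2| <= 2 * (kernel_cst a / Gamma a * h `^ (a / 2) * w).
  rewrite -(ler_pM2l G0) -[X in X * `|_|]ger0_norm ?(ltW G0)// -normrM.
  have -> : Gamma a * (2 * (kernel_cst a / Gamma a * h `^ (a / 2) * w)) =
      kernel_cst a * h `^ (a / 2) * w + kernel_cst a * h `^ (a / 2) * w.
    by field; rewrite gt_eqF.
  have -> : Gamma a * (c1 - c2) = (s `^ (a - 1) - Gamma a * c2) -
      (s `^ (a - 1) - Gamma a * c1) by ring.
  apply: le_trans (ler_normB _ _) _; apply: lerD => //.
  apply: le_trans K1 _; rewrite ler_wpM2r// ler_wpM2l//; exact: ltW.
apply: le_trans (ler_pM (normr_ge0 _) (normr_ge0 _) cc dE) _.
by rewrite le_eqVlt; apply/orP; left; apply/eqP; ring.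
Qed.

(** A crude bound through the absolute sum of the coefficients. It degenerates as h tends to 0 and
    serves at fixed h, or for increments of order h. *)
Lemma fdiff_lip a h P G t t' (L : R) : 0 < a < 1 -> 0 < h -> 0 <= L ->
  (forall j, `|G (t - j%:R * h) - G (t' - j%:R * h)| <= L) ->
  `|fdiff a h P G t - fdiff a h P G t'| <= 2 * h `^ (a - 1) * L.
Proof.
move=> a01 h0 L0 GL; rewrite /fdiff /GRing.scale/= -mulrBr normrM.
rewrite ger0_norm ?powR_ge0// -mulrA mulrCA ler_wpM2l ?powR_ge0//.
rewrite -sumrB; apply: le_trans (ler_norm_sum _ _ _) _.
apply: (@le_trans _ _ (\sum_(j < P) `|acoef (a - 1) j| * L)).
  by apply: ler_sum => j _; rewrite -mulrBr normrM ler_wpM2l.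
by rewrite -mulr_suml ler_wpM2r// sum_normr_acoef.
Qed.

End FdiffScalar.

(** * Fractional integrals *)

Section PowerKernel.
Context {R : realType}.
Notation mu := (@lebesgue_measure R).
Notation leb := (leb_measure R).
Implicit Types (a b t : R).

Definition abel_kernel b t (tau : R) : R := ((t - tau) `^ (1 - b))^-1.

Lemma abel_kernelE b t tau : abel_kernel b t tau = (t - tau) `^ (b - 1).
Proof. by rewrite /abel_kernel -powRN opprB. Qed.

Lemma abel_kernel_ge0 b t tau : 0 <= abel_kernel b t tau.
Proof. by rewrite invr_ge0 powR_ge0. Qed.

Lemma measurable_abel_kernel b t (D : set R) :
  measurable (D : set (measurableTypeR R)) ->
  measurable_fun (D : set (measurableTypeR R)) (abel_kernel b t).
Proof.
move=> mD; apply: measurable_funTS.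
rewrite (_ : abel_kernel b t = (@powR R ^~ (b - 1)) \o (fun tau : R => t - tau)).
  apply: measurableT_comp; first exact: measurable_powR.
  exact: measurable_funB.
by apply/funext => tau; rewrite abel_kernelE.
Qed.

Lemma is_derive_abel_kernel_primitive b t tau : 0 < b -> tau < t ->
  is_derive tau 1 (fun x : R => - ((t - x) `^ b / b)) (abel_kernel b t tau).
Proof.
move=> b0 tt; rewrite abel_kernelE.
have tp : 0 < t - tau by rewrite subr_gt0.
have h1 : is_derive tau 1 (fun x : R => t - x) (-1).
  by apply: is_derive_eq; rewrite add0r mul1r.
have h2 := is_derive1_powR b tp.
have h3 : is_derive tau 1 ((fun y : R => y `^ b) \o (fun x : R => t - x))
    (b * (t - tau) `^ (b - 1) * -1).
  apply: is_derive1_comp.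
have h4 : is_derive tau 1 (fun x : R => (- b^-1) *: (((fun y : R => y `^ b) \o (fun x : R => t - x)) x : R^o))
   ((- b^-1) *: (b * (t - tau) `^ (b - 1) * -1 : R^o)).
  exact: is_deriveZ.
move: h4; congr (is_derive _ _ _ _).
  by apply/funext => x; rewrite /GRing.scale/= mulNr mulrC.
by rewrite /GRing.scale/=; field; rewrite gt_eqF.
Qed.

(** The singular end is removed, and the fundamental theorem is applied on intervals exhausting [0,
    t[. *)
Lemma integral_abel_kernel b t : 0 < b < 1 -> 0 <= t ->
  (\int[leb]_(x in (`[0%R, t] : set (leb_type R))) (abel_kernel b t x)%:E =
   (t `^ b / b)%:E)%E.
Proof.
move=> /andP[b0 b1] t0.
have mK (D : set R) : measurable (D : set (measurableTypeR R)) ->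
    measurable_fun (D : set (measurableTypeR R)) (fun x => (abel_kernel b t x)%:E).
  by move=> mD; apply/measurable_EFinP; exact: measurable_abel_kernel.
rewrite ge0_integral_leb; first last.
- by move=> x _; rewrite lee_fin abel_kernel_ge0.
- by apply: mK; exact: measurable_itv.
- exact: measurable_itv.
have [<-|tn0] := eqVneq 0 t.
  rewrite set_itv1 integral_set1 powR0 ?mul0r// gt_eqF//.
have {tn0}tp : 0 < t by rewrite lt0r eq_sym tn0.
rewrite -integral_itv_bndo_bndc; last by apply: mK; exact: measurable_itv.
pose J n : set R := `[0, t - t / n.+2%:R]%classic.
have Jt n : 0 < t / n.+2%:R by rewrite divr_gt0.
have bigJ : \bigcup_n J n = `[0, t[%classic.
  apply/seteqP; split=> [x [n _]|x].
    rewrite /J/= !in_itv/= => /andP[-> h] /=; apply: le_lt_trans h _.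
    by rewrite ltrBlDr ltrDl.
  rewrite /J/= in_itv/= => /andP[x0 xt].
  exists (Num.truncn (t / (t - x))) => //=; rewrite in_itv/= x0/=.
  rewrite lerBrDr -lerBrDl ler_pdivrMr//.
  rewrite -ler_pdivrMl ?subr_gt0// mulrC.
  by rewrite (le_trans (ltW (truncnS_gt _)))// ler_nat.
have cv : (\int[mu]_(x in J n) (abel_kernel b t x)%:E @[n --> \oo] -->
    \int[mu]_(x in `[0%R, t[) (abel_kernel b t x)%:E)%E.
  rewrite -bigJ; apply: ge0_nondecreasing_set_cvg_integral => //.
  - apply/nondecreasing_seqP => n; rewrite subsetEset => x.
    rewrite /J/= !in_itv/= => /andP[-> h] /=; apply: le_trans h _.
    by rewrite lerD2l lerN2 ler_pM2l// lef_pV2 ?posrE// ler_nat.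
  - by move=> i; exact: measurable_itv.
  - by move=> i; apply: mK; exact: measurable_itv.
  - by move=> i x _; rewrite lee_fin abel_kernel_ge0.
have JE n : (\int[mu]_(x in J n) (abel_kernel b t x)%:E =
    (t `^ b / b - (t / n.+2%:R) `^ b / b)%:E)%E.
  have ltJ : 0 < t - t / n.+2%:R.
    by rewrite subr_gt0 ltr_pdivrMr// ltr_pMr// ltr1n.
  have dK (x : R) : 0 <= x <= t - t / n.+2%:R ->
      is_derive x 1 (fun x : R => - ((t - x) `^ b / b)) (abel_kernel b t x).
    move=> /andP[_ xt]; apply: is_derive_abel_kernel_primitive => //.
    by apply: le_lt_trans xt _; rewrite ltrBlDr ltrDl.
  rewrite (FTC2_is_derive ltJ dK).
    by rewrite -EFinB subr0 subKr opprK addrC.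
  move=> x /andP[_ xt].
  have xlt : x < t by apply: le_lt_trans xt _; rewrite ltrBlDr ltrDl.
  rewrite (_ : abel_kernel b t = (@powR R ^~ (b - 1)) \o (fun tau : R => t - tau)).
    apply: continuous_comp.
      by apply: cvgB; [exact: cvg_cst|exact: cvg_id].
    apply: differentiable_continuous; apply/derivable1_diffP.
    by apply: derivable_powR; rewrite in_itv/= andbT subr_gt0.
  by apply/funext => tau; rewrite abel_kernelE.
apply: (cvg_unique _ cv) => //.
rewrite (funext JE); apply: cvg_EFin; first exact: nearW.
rewrite -[X in _ --> X]subr0; apply: cvgB; first exact: cvg_cst.
have cV : (n.+2%:R^-1 : R) @[n --> \oo] --> (0 : R).
  by have := @cvg_harmonic R; rewrite -cvg_shiftS.
have c2 : (t / n.+2%:R : R) @[n --> \oo] --> (0 : R).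
  by rewrite -(mulr0 t); apply: cvgM; [exact: cvg_cst|exact: cV].
rewrite -(mul0r b^-1); apply: cvgM; last exact: cvg_cst.
by move/cvg_at_rightP : (powR_cvg0 b0); apply; split => // n.
Qed.

Lemma integrable_abel_kernel b t : 0 < b < 1 -> 0 <= t ->
  leb.-integrable (`[0%R, t] : set (leb_type R)) (EFin \o abel_kernel b t).
Proof.
move=> b01 t0; apply/integrableP; split.
  apply/measurable_EFinP; apply: measurable_fun_leb; first exact: measurable_itv.
  by apply: measurable_abel_kernel; exact: measurable_itv.
under eq_integral => x _ do rewrite gee0_abs ?lee_fin ?abel_kernel_ge0//.
by rewrite integral_abel_kernel// ltry.
Qed.

Lemma Rintegral_abel_kernel b t : 0 < b < 1 -> 0 <= t ->
  \int[leb]_(x in (`[0, t] : set (leb_type R))) abel_kernel b t x = t `^ b / b.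
Proof. by move=> b01 t0; rewrite /Rintegral integral_abel_kernel. Qed.

End PowerKernel.

Section IntegralBound.
Context d (U : measurableType d) (R : realType).
Variable mu : {measure set U -> \bar R}.

Lemma ae_le_integrable (D : set U) (f g : U -> R) :
  measurable D -> measurable_fun D f ->
  mu.-integrable D (EFin \o g) ->
  {ae mu, forall x, D x -> `|f x| <= g x} ->
  mu.-integrable D (EFin \o f) /\
  `|\int[mu]_(x in D) f x| <= \int[mu]_(x in D) `|g x|.
Proof.
move=> mD mf ig fg.
have mg : measurable_fun D g by apply/measurable_EFinP; case/integrableP : ig.
have le : (\int[mu]_(x in D) `|(f x)%:E| <= \int[mu]_(x in D) `|(g x)%:E|)%E.
  apply: ae_ge0_le_integral => //.
  - by apply: measurableT_comp => //; apply/measurable_EFinP.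
  - by apply: measurableT_comp => //; apply/measurable_EFinP.
  - apply: filterS fg => x h Dx; rewrite lee_fin; apply: le_trans (h Dx) _.
    exact: ler_norm.
have fi : mu.-integrable D (EFin \o f).
  apply/integrableP; split; first exact/measurable_EFinP.
  by apply: le_lt_trans le _; case/integrableP : ig.
split=> //; apply: le_trans (le_normr_Rintegral mD fi) _.
rewrite /Rintegral fine_le//.
- by apply: integrable_fin_num => //; exact: integrable_norm.
- by apply: integrable_fin_num => //; exact: integrable_norm.
Qed.

End IntegralBound.

Section RiemannLiouville.
Context {R : realType}.
Notation leb := (leb_measure R).
Implicit Types (a h t T M : R).

(** For t < 0 the interval is empty and the value is 0, so that [prim phi] is its own extension by
    zero, as [fdiff] expects. *)
Definition prim (phi : R -> R) t : R^o :=
  \int[leb]_(x in (`[0, t] : set (leb_type R))) phi x.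

Definition rl a (phi : R -> R) t : R :=
  (Gamma a)^-1 *
  \int[leb]_(x in (`[0, t] : set (leb_type R))) (abel_kernel a t x * phi x).

Lemma RL_integral_coord n a (phi : R -> 'rV[R]_n) t i :
  RL_integral a phi t ord0 i = rl a (fun s => phi s ord0 i) t.
Proof.
rewrite mxE /rl; congr (_ * _); rewrite mxE.
by apply: eq_Rintegral => x _; rewrite mxE.
Qed.

Lemma set_itv_ge_leb (s t : R) : t < s -> (`[s, t]%classic : set (leb_type R)) = set0.
Proof. by move=> ts; rewrite set_itv_ge//= bnd_simp -ltNge. Qed.

Lemma prim_lt0 phi t : t < 0 -> prim phi t = 0.
Proof. by move=> t0; rewrite /prim set_itv_ge_leb// Rintegral_set0. Qed.

Lemma rl_lt0 a phi t : t < 0 -> rl a phi t = 0.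
Proof. by move=> t0; rewrite /rl set_itv_ge_leb// Rintegral_set0 mulr0. Qed.

Lemma negligible_leb1 (t : R) : leb.-negligible [set t].
Proof.
exists [set t]; split => //; first by apply: measurable_leb; exact: measurable_set1.
exact: lebesgue_measure_set1.
Qed.

Lemma ae_leb_imp (P Q : R -> Prop) : (forall x, P x -> Q x) ->
  {ae leb, forall x : R, P x} -> {ae leb, forall x : R, Q x}.
Proof. by move=> PQ; apply: negligibleS => x /=; apply: contra_not; exact: PQ. Qed.

Lemma ae_leb_and (P Q : R -> Prop) :
  {ae leb, forall x : R, P x} -> {ae leb, forall x : R, Q x} ->
  {ae leb, forall x : R, P x /\ Q x}.
Proof.
move=> nP nQ; have := negligibleU nP nQ; apply: negligibleS => x /=.
by move/not_andP.
Qed.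

Lemma ae_leb_neq (t : R) : {ae leb, forall x : R, x != t}.
Proof. by apply: negligibleS (negligible_leb1 t) => x /= /negP; rewrite negbK => /eqP. Qed.

Lemma measurable_fun_itv_sub d (U : measurableType d) T t (g : R -> U) : t <= T ->
  measurable_fun (`[0, T] : set (leb_type R)) g ->
  measurable_fun (`[0, t] : set (leb_type R)) g.
Proof.
move=> tT; apply: measurable_funS; first exact: measurable_itv_leb.
by apply: subset_itvl; rewrite bnd_simp.
Qed.

Lemma integrable_leb_cst (s t c : R) :
  leb.-integrable (`[s, t]%classic : set (leb_type R)) (EFin \o cst c).
Proof.
apply/integrableP; split; first exact/measurable_EFinP/measurable_cst.
rewrite /= integral_cst; last exact: measurable_itv_leb.
apply: lte_mul_pinfty => //.
apply: (@le_lt_trans _ _ (if (s%:E < t%:E) then t%:E - s%:E else 0)%E).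
  by have := @leb_itv R `[s, t] => /= <-.
by case: ifP => _; rewrite ?ltry// -EFinB ltry.
Qed.

Definition ind_le (s x : R) : R := (x <= s)%R%:R.

Section BoundedDensity.
Variables (T M : R) (phi : R -> R).
Hypothesis M0 : 0 <= M.
Hypothesis mphi : measurable_fun (`[0, T]%classic : set (leb_type R)) phi.
Hypothesis bphi : {ae leb, forall t : R, t \in `[0, T] -> `|phi t| <= M}.

Lemma ae_bounded_sub t : t <= T ->
  {ae leb, forall x : R, `[0, t]%classic x -> `|phi x| <= M}.
Proof.
move=> tT; apply: ae_leb_imp bphi => x h /= xt; apply: h.
by move: xt; rewrite !in_itv/= => /andP[-> /le_trans]; apply.
Qed.

Lemma integrable_mul_bounded t (g : R -> R) : t <= T ->
  leb.-integrable (`[0, t] : set (leb_type R)) (EFin \o g) ->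
  leb.-integrable (`[0, t] : set (leb_type R)) (EFin \o (fun x => g x * phi x)).
Proof.
move=> tT ig; have mD := measurable_itv_leb `[0, t].
have mg : measurable_fun (`[0, t] : set (leb_type R)) g.
  by apply/measurable_EFinP; case/integrableP : ig.
have mf : measurable_fun (`[0, t]%classic : set (leb_type R)) (fun x => g x * phi x).
  by apply: measurable_funM => //; exact: measurable_fun_itv_sub mphi.
have iM : leb.-integrable (`[0, t]%classic : set (leb_type R))
    (EFin \o (fun x => M * `|g x|)).
  have := integrableZl mD M (integrable_norm ig).
  by apply: eq_integrable => // x _ /=; rewrite -EFinM.
apply: (proj1 (ae_le_integrable mD mf iM _)).
apply: ae_leb_imp (ae_bounded_sub tT) => x h Dx.
by rewrite normrM mulrC ler_wpM2r// h.
Qed.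

Lemma integrable_bounded s t : 0 <= s -> t <= T ->
  leb.-integrable (`]s, t]%classic : set (leb_type R)) (EFin \o phi).
Proof.
move=> s0 tT; have mD := measurable_itv_leb `]s, t].
have sD : `]s, t] `<=` `[0, T].
  by apply: subset_itv; rewrite bnd_simp.
have mf : measurable_fun (`]s, t]%classic : set (leb_type R)) phi.
  by apply: measurable_funS mphi => //; exact: measurable_itv_leb.
have iM : leb.-integrable (`]s, t]%classic : set (leb_type R)) (EFin \o cst M).
  apply: (integrableS (measurable_itv_leb `[0, T]) mD sD).
  exact: integrable_leb_cst.
apply: (proj1 (ae_le_integrable mD mf iM _)).
by apply: ae_leb_imp bphi => x h Dx; apply: h; exact: sD.
Qed.

Lemma prim_sub s t : 0 <= s -> s <= t -> t <= T ->
  prim phi t - prim phi s =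
  \int[leb]_(x in (`]s, t]%classic : set (leb_type R))) phi x.
Proof.
move=> s0 st tT.
have E : (`[0, t]%classic : set R) = `[0, s] `|` `]s, t].
  by rewrite -itv_bndbnd_setU ?bnd_simp.
rewrite /prim [X in Rintegral _ X _ - _]E Rintegral_setU.
- by rewrite addrAC subrr add0r.
- exact: measurable_itv_leb.
- exact: measurable_itv_leb.
- rewrite -E.
  have := integrable_mul_bounded tT (integrable_leb_cst 0 t 1).
  by apply: eq_integrable => [|x _ /=]; [exact: measurable_itv_leb|rewrite mul1r].
- apply/disj_setPS => y [/=]; rewrite 2!in_itv/= => /andP[_ ys] /andP[].
  by rewrite ltNge ys.
Qed.

(** Used with c = 0 for the Lipschitz bound, and with c the value of a continuous density at the
    right end of a cell. *)
Lemma prim_sub_le s t c eta : 0 <= s -> s <= t -> t <= T -> 0 <= eta ->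
  {ae leb, forall x : R, s < x <= t -> `|phi x - c| <= eta} ->
  `|prim phi t - prim phi s - c * (t - s)| <= eta * (t - s).
Proof.
move=> s0 st tT eta0 H; rewrite prim_sub//.
have mD := measurable_itv_leb `]s, t].
have ic r : leb.-integrable (`]s, t]%classic : set (leb_type R)) (EFin \o cst r).
  apply: (integrableS (measurable_itv_leb `[s, t]) mD); last exact: integrable_leb_cst.
  by apply: subset_itvr; rewrite bnd_simp.
have cstE r : \int[leb]_(x in (`]s, t]%classic : set (leb_type R))) r = r * (t - s).
  rewrite Rintegral_cst//; congr (_ * _).
  have := @leb_itv R `]s, t] => /= ->.
  by move: st; rewrite lte_fin le_eqVlt => /predU1P[->|->]; rewrite ?ltxx ?subrr.
rewrite -cstE -(RintegralB mD (integrable_bounded s0 tT) (ic c)).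
have mf : measurable_fun (`]s, t]%classic : set (leb_type R)) (fun x => phi x - c).
  apply: measurable_funB => //; apply: measurable_funS mphi.
    exact: measurable_itv_leb.
  by apply: subset_itv; rewrite bnd_simp.
have [|_ /le_trans] := ae_le_integrable mD mf (ic eta).
  by apply: ae_leb_imp H => x h; rewrite /= in_itv/=; exact: h.
apply; under eq_Rintegral => x _ do rewrite /= ger0_norm//.
by rewrite cstE.
Qed.

Lemma prim0 : 0 <= T -> prim phi 0 = 0.
Proof.
move=> T0; apply/eqP; rewrite -normr_le0.
have mD := @measurable_itv_leb R `[0, 0].
have := ae_le_integrable mD (measurable_fun_itv_sub T0 mphi)
  (integrable_leb_cst _ _ M) (ae_bounded_sub T0).
move=> [_ /le_trans]; apply.
rewrite /= Rintegral_cst//.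
have := @leb_itv R `[0, 0] => /= ->.
by rewrite ltxx mulr0.
Qed.

Lemma prim_lip s t : 0 <= T -> s <= t -> t <= T ->
  `|prim phi t - prim phi s| <= M * (t - s).
Proof.
move=> T0 st tT.
have pos r v : 0 <= r -> r <= v -> v <= T -> `|prim phi v - prim phi r| <= M * (v - r).
  move=> r0 rv vT; have := @prim_sub_le r v 0 M r0 rv vT M0.
  rewrite mul0r subr0; apply.
  apply: ae_leb_imp bphi => x h /andP[rx xv]; rewrite subr0; apply: h.
  by rewrite in_itv/= (le_trans xv)// (le_trans r0)// ltW.
have [s0|s0] := leP 0 s; first exact: pos.
rewrite (prim_lt0 _ s0) subr0.
have [t0|t0] := leP 0 t; last first.
  by rewrite prim_lt0// normr0 mulr_ge0// subr_ge0.
have := pos 0 t (lexx _) t0 tT; rewrite prim0// !subr0 => /le_trans; apply.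
by rewrite ler_wpM2l// lerBrDr gerDl ltW.
Qed.

Lemma prim_indicE s t : s <= t -> t <= T ->
  prim phi s = \int[leb]_(x in (`[0, t]%classic : set (leb_type R)))
    (ind_le s x * phi x).
Proof.
move=> st tT; rewrite /prim.
have -> : (`[0, s]%classic : set R) = `[0, t] `&` `]-oo, s].
  apply/seteqP; split=> x /=; rewrite !in_itv/=.
    by move=> /andP[-> xs]; rewrite (le_trans xs st).
  by move=> [/andP[-> _] ->].
rewrite Rintegral_mkcondr; apply: eq_Rintegral => x _.
rewrite patchE /ind_le; case: ifPn => [/set_mem|/negP].
  by rewrite /= in_itv/= => ->; rewrite mul1r.
rewrite inE/= in_itv/= => /negP/negbTE ->.
by rewrite mul0r.
Qed.

Lemma integrable_step (c b : nat -> R) t Q :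
  leb.-integrable (`[0, t]%classic : set (leb_type R))
    (EFin \o (fun x => \sum_(j < Q) c j * ind_le (b j) x)).
Proof.
have mD := measurable_itv_leb `[0, t].
elim: Q => [|Q IH].
  have := integrable_leb_cst 0 t 0.
  by apply: eq_integrable => // x _ /=; rewrite big_ord0.
have i1 : leb.-integrable (`[0, t]%classic : set (leb_type R))
    (EFin \o (fun x => ind_le (b Q) x)).
  have mi : measurable_fun (`[0, t]%classic : set (leb_type R))
      (fun x => ind_le (b Q) x).
    rewrite (_ : (fun x => _) = \1_(`]-oo, b Q]%classic)); last first.
      apply/funext => x; rewrite indicE /ind_le; congr ((nat_of_bool _)%:R).
      by apply/idP/idP; rewrite inE/= in_itv/=.
    exact/measurable_indic/measurable_itv_leb.
  apply: (proj1 (ae_le_integrable mD mi (integrable_leb_cst 0 t 1) _)).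
  by apply: aeW => x _; rewrite ger0_norm//= /ind_le lern1 leq_b1.
have := integrableD mD IH (integrableZl mD (c Q) i1).
by apply: eq_integrable => // x _ /=; rewrite big_ord_recr/= EFinD EFinM.
Qed.

Lemma sum_prim (c : nat -> R) (b : nat -> R) t Q : t <= T ->
  (forall j, b j <= t) ->
  \sum_(j < Q) c j * prim phi (b j) =
  \int[leb]_(x in (`[0, t]%classic : set (leb_type R)))
    ((\sum_(j < Q) c j * ind_le (b j) x) * phi x).
Proof.
move=> tT bt; have mD := measurable_itv_leb `[0, t].
elim: Q => [|Q IH].
  rewrite big_ord0; under eq_Rintegral => x _ do rewrite big_ord0 mul0r.
  by rewrite Rintegral_cst// mul0r.
rewrite big_ord_recr/= IH (prim_indicE (bt Q) tT).
have i1 : leb.-integrable (`[0, t]%classic : set (leb_type R))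
    (EFin \o (fun x => ind_le (b Q) x * phi x)).
  apply: integrable_mul_bounded => //.
  have := integrable_step (cst 1) (cst (b Q)) t 1.
  by apply: eq_integrable => // x _ /=; rewrite big_ord_recr big_ord0/= add0r mul1r.
rewrite -(RintegralZl _ mD i1) -RintegralD//.
- by apply: eq_Rintegral => x _; rewrite big_ord_recr/= mulrDl mulrA.
- apply: integrable_mul_bounded => //; exact: integrable_step.
- have := integrableZl mD (c Q) i1.
  by apply: eq_integrable => // x _ /=; rewrite EFinM.
Qed.

(** [fdiff] of the primitive is one integral of phi against a step function [kap], to which
    [kernel_bound] applies at s = t - x; the remaining kernel s^(a/2 - 1) integrates to t^(a/2) /
    (a/2). *)
Lemma rl_fdiff a h P t : 0 < a < 1 -> 0 < h -> 0 <= t -> t <= T -> t < P%:R * h ->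
  `|rl a phi t - fdiff a h P (prim phi) t| <=
  kernel_cst a / Gamma a * h `^ (a / 2) * (t `^ (a / 2) / (a / 2)) * M.
Proof.
move=> a01 h0 t0 tT tP; have /andP[a0 a1] := a01.
have a201 : 0 < a / 2 < 1 by lra.
have G0 := Gamma_gt0 a01; have C0 := kernel_cst_gt0 a01.
have mD := measurable_itv_leb `[0, t].
rewrite /fdiff /GRing.scale/=.
rewrite (sum_prim (acoef (a - 1)) (b := fun j => t - j%:R * h) P tT); last by move=> j; rewrite gerBl mulr_ge0// ltW.
set kap := fun x : R => \sum_(j < P) acoef (a - 1) j * ind_le (t - j%:R * h) x.
(* The indicators present at x are those with j h <= t - x, so [kap x] is a partial sum of
   [acoef (a - 1)], that is [acoef a k] with k the cell of t - x. *)
have kapE x : x \in `[0, t] -> kap x = acoef a (Num.truncn ((t - x) / h)).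
  rewrite in_itv/= => /andP[x0 xt].
  have tx0 : 0 <= (t - x) / h by rewrite divr_ge0 ?(ltW h0)// subr_ge0.
  set k := Num.truncn _.
  have kP : (k < P)%N.
    rewrite truncn_lt_nat// ltr_pdivrMr//; apply: le_lt_trans tP.
    by rewrite gerBl.
  have jE (j : nat) : (x <= t - j%:R * h) = (j < k.+1)%N.
    by rewrite ltnS /k truncn_ge_nat// ler_pdivlMr// lerBrDr -lerBrDl.
  rewrite -[a in RHS](subrK 1) -sum_acoef.
  rewrite (big_ord_widen P (fun j => acoef (a - 1) j) kP) [RHS]big_mkcond/=.
  by apply: eq_bigr => j _; rewrite /ind_le jE; case: ifP; rewrite ?mulr1 ?mulr0.
have ik : leb.-integrable (`[0, t]%classic : set (leb_type R))
    (EFin \o (fun x => abel_kernel a t x * phi x)).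
  by apply: integrable_mul_bounded => //; exact: integrable_abel_kernel.
have is_ : leb.-integrable (`[0, t]%classic : set (leb_type R))
    (EFin \o (fun x => kap x * phi x)).
  exact: (integrable_mul_bounded tT (integrable_step (acoef (a - 1)) (fun j => t - j%:R * h) t P)).
set I1 := Rintegral _ _ _.
have -> : rl a phi t - h `^ (a - 1) * I1 = (Gamma a)^-1 *
    \int[leb]_(x in (`[0, t]%classic : set (leb_type R)))
      (abel_kernel a t x * phi x - (Gamma a * h `^ (a - 1)) * (kap x * phi x)).
  rewrite RintegralB//; last first.
    have := integrableZl mD (Gamma a * h `^ (a - 1)) is_.
    by apply: eq_integrable => // x _ /=; rewrite EFinM.
  rewrite RintegralZl// /rl mulrBr; congr (_ - _).
  by rewrite mulrA [_^-1 * _]mulrA mulVf ?mul1r// gt_eqF.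
rewrite normrM ger0_norm ?invr_ge0 ?(ltW G0)//.
pose K := kernel_cst a * h `^ (a / 2) * M.
have K0 : 0 <= K by rewrite !mulr_ge0 ?powR_ge0 ?(ltW C0).
have iK : leb.-integrable (`[0, t]%classic : set (leb_type R))
    (EFin \o (fun x => K * abel_kernel (a / 2) t x)).
  have := integrableZl mD K (integrable_abel_kernel a201 t0).
  by apply: eq_integrable => // x _ /=; rewrite EFinM.
have := @ae_le_integrable _ _ R leb _ (fun x => abel_kernel a t x * phi x -
   (Gamma a * h `^ (a - 1)) * (kap x * phi x)) _ mD _ iK.
move=> /(_ _ _)[].
- apply: measurable_funB; first by apply/measurable_EFinP; case/integrableP : ik.
  apply: measurable_funM; first exact: measurable_cst.
  by apply/measurable_EFinP; case/integrableP : is_.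
- apply: ae_leb_imp (ae_leb_and (ae_leb_neq t) (ae_bounded_sub tT)) => x [xt h1] Dx.
  have {h1} phix := h1 Dx.
  move: (Dx); rewrite /= in_itv/= => /andP[x0 xt'].
  have {xt xt'}xt : x < t by rewrite lt_neqAle xt.
  have tx : 0 < t - x by rewrite subr_gt0.
  rewrite kapE//.
  have -> : abel_kernel a t x * phi x - Gamma a * h `^ (a - 1) *
      (acoef a (Num.truncn ((t - x) / h)) * phi x) =
    ((t - x) `^ (a - 1) - Gamma a * (h `^ (a - 1) *
      acoef a (Num.truncn ((t - x) / h)))) * phi x.
    by rewrite abel_kernelE; ring.
  rewrite normrM abel_kernelE /K.
  rewrite [leRHS](_ : _ = kernel_cst a * h `^ (a / 2) * (t - x) `^ (a / 2 - 1) * M);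
    last by ring.
  apply: ler_pM => //; apply: kernel_bound => //.
  rewrite -ler_pdivlMr// -ltr_pdivrMr//; apply: truncn_itv.
  by rewrite divr_ge0// ltW.
- move=> _ H; rewrite mulrC ler_pdivrMr//; apply: le_trans H _.
  have -> : \int[leb]_(x in (`[0, t]%classic : set (leb_type R)))
      `|K * abel_kernel (a / 2) t x| = K * (t `^ (a / 2) / (a / 2)).
    rewrite -Rintegral_abel_kernel// -RintegralZl//; last exact: integrable_abel_kernel.
    apply: eq_Rintegral => x _.
    by rewrite ger0_norm// mulr_ge0// abel_kernel_ge0.
  rewrite /K le_eqVlt; apply/orP; left; apply/eqP.
  by field; rewrite !gt_eqF.
Qed.

End BoundedDensity.
End RiemannLiouville.

(** * Uniform comparison, continuity and inversion of fractional integrals *)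

Section Inversion.
Context {R : realType}.
Notation leb := (leb_measure R).
Implicit Types (a h t T M L : R).

Lemma le_of_powR_bound (p h A B X : R) : 0 < p -> 0 < h ->
  (forall m : nat, X <= A * (h / m.+1%:R) `^ p + B) -> X <= B.
Proof.
move=> p0 h0 H.
have cV : (h / m.+1%:R : R) @[m --> \oo] --> (0 : R).
  by rewrite -(mulr0 h); apply: cvgM; [exact: cvg_cst|exact: cvg_harmonic].
have c0 : ((h / m.+1%:R : R) `^ p) @[m --> \oo] --> (0 : R).
  move/cvg_at_rightP : (powR_cvg0 p0); apply; split => // m.
  by rewrite divr_gt0.
have cr : (A * (h / m.+1%:R) `^ p + B) @[m --> \oo] --> B.
  rewrite -[X in _ --> X]add0r; apply: cvgD; last exact: cvg_cst.
  by rewrite -(mulr0 A); apply: cvgM; [exact: cvg_cst|exact: c0].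
apply: (ler_cvg_to (cvg_cst X) cr); exact: nearW.
Qed.

(** One more than the integer part: the grid passes strictly beyond T, where zero extensions vanish,
    but by at most h. *)
Definition grid_size T h : nat := (Num.truncn (T / h)).+1.

Lemma grid_size_gt T h : 0 < h -> T < (grid_size T h)%:R * h.
Proof. by move=> h0; rewrite -ltr_pdivrMr// truncnS_gt. Qed.

Lemma grid_size_le T h : 0 < h -> 0 <= T -> (grid_size T h)%:R * h <= T + h.
Proof.
move=> h0 T0; rewrite /grid_size -natr1 mulrDl mul1r lerD2r -ler_pdivlMr//.
by rewrite truncn_le divr_ge0 ?(ltW h0).
Qed.

Section Density.
Variables (T M : R) (phi : R -> R).
Hypothesis T0 : 0 <= T.
Hypothesis M0 : 0 <= M.
Hypothesis mphi : measurable_fun (`[0, T]%classic : set (leb_type R)) phi.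
Hypothesis bphi : {ae leb, forall t : R, t \in `[0, T] -> `|phi t| <= M}.

Let F := prim phi.

Let F_le0 s : s <= 0 -> F s = 0.
Proof.
rewrite le_eqVlt => /predU1P[->|s0]; last exact: prim_lt0.
exact: (prim0 mphi bphi T0).
Qed.

Lemma fdiff_prim_le0 a h P t : 0 < h -> t <= 0 -> fdiff a h P F t = 0.
Proof.
move=> h0 t0; rewrite /fdiff big1 ?scaler0// => j _.
by rewrite F_le0 ?scaler0// lerBlDr add0r (le_trans t0)// mulr_ge0// ltW.
Qed.

(* Unlike [rl_fdiff], this bound involves only a Lipschitz constant of the
   primitive; it is obtained by letting m go to infinity in the comparison of the
   steps h and h / m. *)
Lemma rl_fdiff_lip a h P t L : 0 < a < 1 -> 0 < h -> 0 <= t -> t <= T ->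
  t < P%:R * h ->
  (forall r s, r <= s -> s <= T -> `|F s - F r| <= L * (s - r)) ->
  `|rl a phi t - fdiff a h P F t| <=
  kernel_cst a / Gamma a * h `^ (a / 2) *
    (4 / (a / 2) * (P%:R * h) `^ (a / 2)) * L.
Proof.
move=> a01 h0 t0 tT tP FL; have /andP[a0 a1] := a01.
have p0 : 0 < a / 2 by lra.
apply: (le_of_powR_bound (A := kernel_cst a / Gamma a * (t `^ (a / 2) / (a / 2)) * M)
  p0 h0) => m.
have hm0 : 0 < h / m.+1%:R by rewrite divr_gt0.
have hmE : (P * m.+1)%:R * (h / m.+1%:R) = P%:R * h.
  by rewrite natrM; field; rewrite nat1r pnatr_eq0.
have tPm : t < (P * m.+1)%:R * (h / m.+1%:R) by rewrite hmE.
have H1 := rl_fdiff M0 mphi bphi a01 hm0 t0 tT tPm.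
have H2 := @fdiff_refine R a h P m.+1 F t L a01 h0 isT.
have {}H2 := H2 _ _.
rewrite -[rl a phi t](subrK (fdiff a (h / m.+1%:R) (P * m.+1) F t)) -addrA.
apply: le_trans (ler_normD _ _) _; apply: lerD.
  by apply: le_trans H1 _; rewrite le_eqVlt; apply/orP; left; apply/eqP; ring.
apply: H2; last by rewrite F_le0// subr_le0 ltW.
move=> s st; apply: le_trans (FL _ _ _ _) _.
- by rewrite lerBlDr lerDl ltW.
- exact: le_trans tT.
- by rewrite subKr.
Qed.

Let K1 a := kernel_cst a / Gamma a * (T `^ (a / 2) / (a / 2)) * M.

Let K1_ge0 a : 0 < a < 1 -> 0 <= K1 a.
Proof.
move=> a01; have /andP[a0 a1] := a01.
by rewrite !mulr_ge0 ?invr_ge0 ?powR_ge0 ?(ltW (kernel_cst_gt0 a01)) ?(ltW (Gamma_gt0 a01))//; lra.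
Qed.

Lemma rl_fdiff_unif a h P t : 0 < a < 1 -> 0 < h -> t <= T -> T < P%:R * h ->
  `|rl a phi t - fdiff a h P F t| <= K1 a * h `^ (a / 2).
Proof.
move=> a01 h0 tT TP; have /andP[a0 a1] := a01.
have [t0|t0] := leP 0 t; last first.
  rewrite rl_lt0// fdiff_prim_le0 ?(ltW t0)// subrr normr0.
  by rewrite mulr_ge0 ?K1_ge0 ?powR_ge0.
apply: le_trans (rl_fdiff M0 mphi bphi a01 h0 t0 tT (le_lt_trans tT TP)) _.
rewrite /K1 [leRHS](_ : _ = kernel_cst a / Gamma a * h `^ (a / 2) *
  (T `^ (a / 2) / (a / 2)) * M); last by ring.
rewrite ler_wpM2r// ler_wpM2l//.
  by rewrite !mulr_ge0 ?invr_ge0 ?powR_ge0 ?(ltW (kernel_cst_gt0 a01)) ?(ltW (Gamma_gt0 a01)).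
rewrite ler_wpM2r ?invr_ge0; [|lra|].
  done.
by apply: ge0_ler_powR; rewrite ?nnegrE//; lra.
Qed.

(** At t = 0 the error bound of [rl_fdiff] contains the factor 0^(a/2) = 0. *)
Lemma rl_at0 a : 0 < a < 1 -> rl a phi 0 = 0.
Proof.
move=> a01; have /andP[a0 a1] := a01.
have H := rl_fdiff M0 mphi bphi (P := 1) a01 ltr01 (lexx 0) T0.
move: H; rewrite mul1r => /(_ ltr01).
rewrite fdiff_prim_le0// subr0 powR0 ?mul0r ?mulr0 ?mul0r ?normr_le0; last lra.
by move=> /eqP.
Qed.

(** Both values are compared with [fdiff] at the same step h, which stays free: it is chosen before
    t' approaches t. *)
Lemma rl_modulus a h t t' : 0 < a < 1 -> 0 < h -> t <= T -> t' <= T ->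
  `|rl a phi t - rl a phi t'| <=
    2 * (K1 a * h `^ (a / 2)) + 2 * h `^ (a - 1) * (M * `|t - t'|).
Proof.
move=> a01 h0 tT t'T; set P := grid_size T h.
have TP : T < P%:R * h by exact: grid_size_gt.
have H1 := rl_fdiff_unif a01 h0 tT TP.
have H2 := rl_fdiff_unif a01 h0 t'T TP.
have H3 : `|fdiff a h P F t - fdiff a h P F t'| <= 2 * h `^ (a - 1) * (M * `|t - t'|).
  apply: fdiff_lip => //; first by rewrite mulr_ge0.
  move=> j.
  have jT s : s <= T -> s - j%:R * h <= T.
    by move=> sT; rewrite lerBlDr (le_trans sT)// lerDl mulr_ge0// ltW.
  have [tt|/ltW tt] := leP t t'.
    rewrite distrC [`|t - t'|]distrC [`|t' - t|]ger0_norm ?subr_ge0//.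
    have := prim_lip M0 mphi bphi T0 (_ : t - j%:R * h <= t' - j%:R * h) (jT _ t'T).
    rewrite lerD2r => /(_ tt) /le_trans; apply.
    by rewrite opprB addrA subrK.
  rewrite [`|t - t'|]ger0_norm ?subr_ge0//.
  have := prim_lip M0 mphi bphi T0 (_ : t' - j%:R * h <= t - j%:R * h) (jT _ tT).
  rewrite lerD2r => /(_ tt) /le_trans; apply.
  by rewrite opprB addrA subrK.
have split_sub (p q p' q' : R) : p - q = (p - p') - (q - q') + (p' - q') by ring.
rewrite (split_sub _ _ (fdiff a h P F t) (fdiff a h P F t')).
apply: le_trans (ler_normD _ _) (lerD _ H3).
apply: le_trans (ler_normB _ _) _.
by rewrite mulr2n mulrDl mul1r lerD.
Qed.

Lemma rl_bounded a : 0 < a < 1 ->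
  exists2 B, 0 <= B & forall t, t <= T -> `|rl a phi t| <= B.
Proof.
move=> a01; pose h := T + 1; have h0 : 0 < h by rewrite ltr_wpDl.
exists (2 * (K1 a * h `^ (a / 2)) + 2 * h `^ (a - 1) * (M * T)).
  by apply: addr_ge0; apply: mulr_ge0 => //; apply: mulr_ge0; rewrite ?powR_ge0// K1_ge0.
move=> t tT; have [t0|t0] := leP 0 t; last first.
  rewrite rl_lt0// normr0.
  by apply: addr_ge0; apply: mulr_ge0 => //; apply: mulr_ge0; rewrite ?powR_ge0// K1_ge0.
have := rl_modulus a01 h0 tT T0; rewrite rl_at0// !subr0 => /le_trans; apply.
rewrite lerD2l ler_wpM2l ?mulr_ge0 ?powR_ge0// ler_wpM2l//.
by rewrite ger0_norm.
Qed.

Lemma measurable_rl a : 0 < a < 1 ->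
  measurable_fun (`[0, T]%classic : set (leb_type R)) (rl a phi).
Proof.
move=> a01; have /andP[a0 a1] := a01.
(* Freezing the argument at T gives a function continuous on the whole line. In the proof h makes
   the first term of [rl_modulus] at most e / 2, and then D fixes the distance. *)
pose v t := rl a phi (Num.min t T).
have cv : continuous v.
  move=> t; apply/cvgrPdist_le => /= e e0.
  pose C := 2 * K1 a + 1; have C0 : 0 < C by rewrite ltr_wpDl// mulr_ge0// K1_ge0.
  pose h := (e / 2 / C) `^ (a / 2)^-1.
  have h0 : 0 < h by rewrite powR_gt0// !divr_gt0.
  pose D := 2 * h `^ (a - 1) * M + 1.
  have D0 : 0 < D by rewrite ltr_wpDl// !mulr_ge0 ?powR_ge0.
  near=> s.
  apply: le_trans (rl_modulus a01 h0 _ _) _; try by rewrite ge_min lexx orbT.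
  have hE : h `^ (a / 2) = e / 2 / C.
    rewrite -powRrM mulVf ?powRr1//; last by rewrite gt_eqF//; lra.
    by rewrite !divr_ge0// ltW.
  have ts : `|Num.min t T - Num.min s T| <= e / 2 / D.
    apply: (@le_trans _ _ `|t - s|).
      have := ler_norm (t - s); have := ler_norm (s - t); rewrite distrC ler_norml.
      by case: (leP t T); case: (leP s T) => *; lra.
    near: s.
    have d0 : 0 < e / 2 / D by rewrite !divr_gt0.
    by move/cvgrPdist_le : (@cvg_id _ (nbhs t)) => /(_ _ d0).
  rewrite hE [leRHS]splitr; apply: lerD.
    have -> : 2 * (K1 a * (e / 2 / C)) = e / 2 * (2 * K1 a / C) by ring.
    apply: ler_piMr; first by rewrite divr_ge0// ltW.
    by rewrite ler_pdivrMr// mul1r /C lerDl.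
  rewrite mulrA; apply: (@le_trans _ _ (D * (e / 2 / D))); last first.
    by rewrite mulrCA divff ?mulr1// gt_eqF.
  by apply: ler_pM => //; rewrite ?mulr_ge0 ?powR_ge0// /D lerDl.
have mv : measurable_fun (`[0, T]%classic : set (leb_type R)) v.
  apply: measurable_fun_leb; first exact: measurable_itv.
  by apply: measurable_funTS; exact: continuous_measurable_fun.
apply: eq_measurable_fun mv => x; rewrite inE/= in_itv/= => /andP[_ xT].
by rewrite /v min_l.
Unshelve. all: by end_near. Qed.

End Density.
End Inversion.

Section Inverse.
Context {R : realType}.
Notation leb := (leb_measure R).
Implicit Types (a h t : R).
Variables (T M : R) (phi : R -> R).
Hypothesis T0 : 0 <= T.
Hypothesis M0 : 0 <= M.
Hypothesis mphi : measurable_fun (`[0, T]%classic : set (leb_type R)) phi.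
Hypothesis bphi : {ae leb, forall t : R, t \in `[0, T] -> `|phi t| <= M}.

Lemma rl_cell_bound a h eta s : 0 < a < 1 -> 0 < h -> 0 <= eta -> s <= T ->
  (forall r r', r <= T -> r' <= T -> `|r - r'| <= h ->
     `|rl a phi r - rl a phi r'| <= eta) ->
  `|prim (rl a phi) s - prim (rl a phi) (s - h) - h * rl a phi s| <= h * eta.
Proof.
move=> a01 h0 eta0 sT ueta; set u := rl a phi.
have mu_ := measurable_rl T0 M0 mphi bphi a01.
have [B B0 uB] := rl_bounded T0 M0 mphi bphi a01.
have bu : {ae leb, forall t : R, t \in `[0, T] -> `|u t| <= B}.
  by apply: aeW => t; rewrite in_itv/= => /andP[_]; exact: uB.
have cell r : 0 <= r -> r <= s -> s - h <= r ->
    `|prim u s - prim u r - u s * (s - r)| <= eta * (s - r).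
  move=> r0 rs shr; apply: (prim_sub_le mu_ bu) => //.
  apply: aeW => x /andP[rx xs]; apply: ueta => //; first exact: le_trans sT.
  by rewrite ler0_norm; lra.
have [hs|sh] := leP h s.
  have := cell (s - h); rewrite subKr mulrC [eta * h]mulrC; apply; lra.
have [s0|s0] := leP 0 s; last first.
  rewrite /u rl_lt0// prim_lt0// prim_lt0; last by rewrite subr_lt0 (lt_trans s0).
  by rewrite mulr0 !subr0 normr0 mulr_ge0// ltW.
(* Here 0 <= s < h: the part of the cell below 0 contributes nothing to the primitive, and the
   missing (h - s) u(s) is small because u vanishes at 0, within h of s. *)
have u00 : u 0 = 0 by exact: (rl_at0 T0 M0 mphi bphi).
have us : `|u s| <= eta.
  have := ueta s 0 sT T0; rewrite -/u u00 !subr0; apply.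
  by rewrite ger0_norm// ltW.
have c0 := cell 0 (lexx _) s0.
rewrite (prim0 mu_ bu T0) !subr0 in c0.
rewrite [prim u (s - h)]prim_lt0 ?subr_lt0// subr0.
have -> : prim u s - h * u s = (prim u s - u s * s) - (h - s) * u s by ring.
apply: le_trans (ler_normB _ _) _.
have hs0 : 0 <= h - s by rewrite subr_ge0 ltW.
have -> : h * eta = eta * s + (h - s) * eta by ring.
rewrite lerD ?c0 ?lerBlDr ?lerDl//; first by lra.
by rewrite normrM ger0_norm// ler_wpM2l.
Qed.

(* The coefficients of (1 - z) ^ (a - 1) and (1 - z) ^ (1 - a) are convolution
   inverses of each other, so that the discretized [rl (1 - a)] undoes [fdiff a];
   this replaces Fubini's theorem and the Beta function. *)
Lemma rl_inverse a t : 0 < a < 1 -> 0 <= t -> t <= T ->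
  rl (1 - a) (rl a phi) t = prim phi t.
Proof.
move=> a01 t0 tT; have /andP[a0 a1] := a01.
pose b := 1 - a; have b01 : 0 < b < 1 by rewrite /b; lra.
have /andP[b0 b1] := b01.
set u := rl a phi; set F := prim phi.
have mu_ := measurable_rl T0 M0 mphi bphi a01.
have [B B0 uB] := rl_bounded T0 M0 mphi bphi a01.
have bu : {ae leb, forall t : R, t \in `[0, T] -> `|u t| <= B}.
  by apply: aeW => s; rewrite in_itv/= => /andP[_]; exact: uB.
pose K := kernel_cst a / Gamma a * (T `^ (a / 2) / (a / 2)) * M.
have K0 : 0 <= K.
  by rewrite !mulr_ge0 ?invr_ge0 ?powR_ge0 ?(ltW (kernel_cst_gt0 a01)) ?(ltW (Gamma_gt0 a01))//; lra.
pose K' := kernel_cst b / Gamma b * (T `^ (b / 2) / (b / 2)) * B.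
have K'0 : 0 <= K'.
  by rewrite !mulr_ge0 ?invr_ge0 ?powR_ge0 ?(ltW (kernel_cst_gt0 b01)) ?(ltW (Gamma_gt0 b01))//; lra.
pose C := acoef_cst b / b * (T + 1) `^ b.
have C0 : 0 <= C.
  by rewrite mulr_ge0 ?powR_ge0// divr_ge0 ?(ltW b0)// ltW// acoef_cst_gt0.
have est h : 0 < h <= 1 -> `|rl b u t - F t| <=
    K' * h `^ (b / 2) + C * (3 * K * h `^ (a / 2) + 2 * M * h `^ a).
  move=> /andP[h0 h1]; set P := grid_size T h.
  have TP : T < P%:R * h by exact: grid_size_gt.
  have Ph : P%:R * h <= T + 1 by apply: le_trans (grid_size_le h0 T0) _; lra.
  have tP := le_lt_trans tT TP.
  pose eps := K * h `^ (a / 2).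
  pose eta := 2 * eps + 2 * M * h `^ a.
  have eps0 : 0 <= eps by rewrite mulr_ge0 ?powR_ge0.
  have eta0 : 0 <= eta.
    by apply: addr_ge0; apply: mulr_ge0; rewrite ?powR_ge0// mulr_ge0.
  have ueta r r' : r <= T -> r' <= T -> `|r - r'| <= h -> `|u r - u r'| <= eta.
    move=> rT r'T rr.
    apply: le_trans (rl_modulus T0 M0 mphi bphi a01 h0 rT r'T) _.
    rewrite -/K -/eps lerD2l -(mulr_powRB1 (ltW h0) a0).
    rewrite [leRHS](_ : _ = 2 * h `^ (a - 1) * (M * h)); last by ring.
    by rewrite ler_wpM2l ?mulr_ge0 ?powR_ge0// ler_wpM2l.
  have H1 : `|rl b u t - fdiff b h P (prim u) t| <= K' * h `^ (b / 2).
    exact: (rl_fdiff_unif T0 B0 mu_ bu b01 h0 tT TP).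
  (* The increment of [prim u] over a cell is close to h u(s), hence to h times [fdiff a] of F at s;
     [fdiff_inverse] sums the latter exactly to F t. *)
  have H2 : `|fdiff b h P (prim u) t - F t| <= C * (eta + eps).
    rewrite fdiff_abel; last by rewrite prim_lt0// subr_lt0.
    rewrite -(@fdiff_inverse R a h P F t h0 _ tP); last by move=> s; exact: prim_lt0.
    rewrite -sumrB; apply: le_trans (ler_norm_sum _ _ _) _.
    apply: (@le_trans _ _ (\sum_(k < P) h `^ b * acoef b k * (eta + eps))); last first.
      rewrite -mulr_suml ler_wpM2r//; first exact: addr_ge0.
      apply: le_trans (sum_acoef_le P b01 h0) _.
      apply: ler_wpM2l; first by rewrite divr_ge0 ?(ltW b0)// ltW// acoef_cst_gt0.
      by apply: ge0_ler_powR; rewrite ?nnegrE ?(ltW b0)// ?mulr_ge0 ?(ltW h0)// addr_ge0.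
    apply: ler_sum => k _.
    set s := t - k%:R * h.
    have sT : s <= T by rewrite lerBlDr (le_trans tT)// lerDl mulr_ge0// ltW.
    have -> : t - k.+1%:R * h = s - h by rewrite /s -natr1; ring.
    have cell := rl_cell_bound a01 h0 eta0 sT ueta.
    have fd : `|u s - fdiff a h P F s| <= eps.
      exact: (rl_fdiff_unif T0 M0 mphi bphi a01 h0 sT TP).
    rewrite /GRing.scale/= -/b.
    have -> : h `^ (b - 1) * acoef b k * (prim u s - prim u (s - h)) -
        h `^ b * acoef b k * fdiff a h P F s =
      h `^ (b - 1) * acoef b k * ((prim u s - prim u (s - h) - h * u s) +
        h * (u s - fdiff a h P F s)).
      by rewrite -(mulr_powRB1 (ltW h0) b0); ring.
    have -> : h `^ b * acoef b k * (eta + eps) =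
        h `^ (b - 1) * acoef b k * (h * eta + h * eps).
      by rewrite -(mulr_powRB1 (ltW h0) b0); ring.
    rewrite normrM ger0_norm; last by rewrite mulr_ge0 ?powR_ge0// ltW// acoef_gt0.
    rewrite ler_wpM2l//; first by rewrite mulr_ge0 ?powR_ge0// ltW// acoef_gt0.
    apply: le_trans (ler_normD _ _) (lerD cell _).
    by rewrite normrM gtr0_norm// ler_wpM2l// ltW.
  rewrite -[rl b u t](subrK (fdiff b h P (prim u) t)) -addrA.
  apply: le_trans (ler_normD _ _) (lerD H1 _).
  apply: le_trans H2 _; rewrite ler_wpM2l// /eta /eps le_eqVlt.
  by apply/orP; left; apply/eqP; ring.
apply/eqP; rewrite -subr_eq0 -normr_le0 -/b.
(* An exponent below b/2, a/2 and a, so that h^p dominates all three powers when h <= 1. *)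
pose p := a * b / 2.
have ab0 : 0 < a * b by rewrite mulr_gt0.
have abl : a * b <= a by rewrite ger_pMr// ltW.
have abl' : a * b <= b by rewrite ger_pMl// ltW.
have p0 : 0 < p by rewrite /p; lra.
apply: (@le_of_powR_bound R p 1 (K' + C * (3 * K + 2 * M)) 0 _ p0 ltr01) => m.
set h := 1 / m.+1%:R.
have h01 : 0 < h <= 1.
  by rewrite /h divr_gt0//= ler_pdivrMr// mul1r ler1n.
apply: le_trans (est h h01) _; rewrite addr0.
have pw q : p <= q -> h `^ q <= h `^ p by move=> pq; exact: ger_powR.
rewrite [leRHS]mulrDl; apply: lerD; first by rewrite ler_wpM2l// pw// /p; lra.
rewrite -[leRHS]mulrA ler_wpM2l// [leRHS]mulrDl; apply: lerD.
  by apply: ler_wpM2l; [rewrite mulr_ge0|apply: pw; rewrite /p; lra].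
by apply: ler_wpM2l; [rewrite mulr_ge0|apply: pw; rewrite /p; lra].
Qed.

End Inverse.

(** * Lipschitz functions differentiable almost everywhere *)

Section Growth.
Context {R : realType} {n : nat}.
Notation mu := (@lebesgue_measure R).
Notation leb := (leb_measure R).
Implicit Types (Y : R -> 'rV[R]_n) (a b c g L : R).

Lemma enorm_le_mx_norm (v : 'rV[R]_n) : enorm v <= n%:R * `|v|.
Proof.
apply: enorm_le_cst => i; rewrite [leRHS]mx_normrE.
exact: (le_bigmax _ (fun ij : 'I_1 * 'I_n => `|v ij.1 ij.2|) (ord0, i)).
Qed.

Lemma derivable_right_bound Y c g (e : R) : derivable Y c 1 ->
  enorm (derive1 Y c) <= g -> 0 < e ->
  exists2 d, 0 < d & forall s, c < s -> s < c + d ->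
    enorm (Y s - Y c) <= (g + e) * (s - c).
Proof.
move=> dY Yg e0.
(* Derivability refers to the sup norm; passing to the Euclidean norm costs a factor n, and n + 1
   keeps the quotient meaningful for n = 0. *)
have e'0 : 0 < e / n.+1%:R by rewrite divr_gt0.
move/cvgrPdist_le : dY => /(_ _ e'0)[r /= r0 H].
exists r => // s cs sr.
have sc : 0 < s - c by rewrite subr_gt0.
have nE : `|0 - (s - c)| = s - c by rewrite sub0r normrN gtr0_norm.
set D := derive1 Y c in Yg; set W := Y s - Y c.
have {}H : `|D - (s - c)^-1 *: W| <= e / n.+1%:R.
  have := H (s - c) _ (lt0r_neq0 sc).
  have -> : (s - c)^-1 *: W = (s - c)^-1 *: ((Y \o shift c) ((s - c) *: 1) - Y c).
    by rewrite /= /GRing.scale/= mulr1 subrK.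
  rewrite /D derive1E; apply.
  by rewrite /= nE ltrBlDl.
have E : enorm ((s - c)^-1 *: W) <= g + e.
  rewrite (_ : (s - c)^-1 *: W = D - (D - (s - c)^-1 *: W)); last by rewrite subKr.
  apply: le_trans (enormD _ _) _; rewrite enormN; apply: lerD => //.
  apply: le_trans (enorm_le_mx_norm _) _.
  apply: (@le_trans _ _ (n%:R * (e / n.+1%:R))); first by rewrite ler_wpM2l.
  rewrite mulrCA ler_piMr// ?(ltW e0)// ler_pdivrMr// mul1r ler_nat//.
rewrite enormZ gtr0_norm ?invr_gt0// in E.
by rewrite mulrC -ler_pdivrMl.
Qed.

Let excess (U : set R) a t : R := fine (mu (U `&` `[a, t])).

(* On the exceptional null set, covered by an open set U of measure at most e, the
   growth L of Y is absorbed by that of L * mu (U `&` `[a, t]). *)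
Lemma growth_le Y a b g L : a <= b -> 0 <= L -> 0 <= g ->
  (forall s t, a <= s <= b -> a <= t <= b -> enorm (Y s - Y t) <= L * `|s - t|) ->
  {ae leb, forall t : R, a <= t <= b ->
     derivable Y t 1 /\ enorm (derive1 Y t) <= g} ->
  enorm (Y b - Y a) <= g * (b - a).
Proof.
move=> ab L0 g0 YL [E [mE E0 badE]].
(* The slack e is both an extra slope at the points of derivability and the measure allowed to U. *)
suff H e : 0 < e -> enorm (Y b - Y a) <= (g + e) * (b - a) + L * e.
  have ba1 : 0 < b - a + L + 1 by lra.
  apply/ler_addgt0Pr => e e0; have d0 : 0 < e / (b - a + L + 1) by rewrite divr_gt0.
  apply: le_trans (H _ d0) _; rewrite mulrDl -addrA lerD2l.
  rewrite [X in _ + X]mulrC -mulrDr -mulrA ler_piMr ?(ltW e0)//.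
  by rewrite mulrC ler_pdivrMr// mul1r; lra.
move=> e0.
have [U [oU EU Ue]] := outer_measure_open_le E e0.
have {}Ue : (mu U <= e%:E)%E.
  apply: le_trans Ue _; rewrite (_ : ((wlength idfun)^* E)%mu = 0%E) ?add0e//.
have mU : measurable (U : set (measurableTypeR R)) by exact: open_measurable.
have mUt t : measurable (U `&` `[a, t] : set (measurableTypeR R)).
  by apply: measurableI => //; exact: measurable_itv.
have Ut_le t : (mu (U `&` `[a, t]) <= e%:E)%E.
  by apply: le_trans Ue; apply: le_measure; rewrite ?inE.
have Ut_fin t : (mu (U `&` `[a, t]) \is a fin_num)%E.
  by rewrite ge0_fin_numE// (le_lt_trans (Ut_le t))// ltry.
pose m := excess U a.
have m_ge0 t : 0 <= m t by rewrite fine_ge0.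
have m_le t : m t <= e by rewrite -lee_fin fineK.
have m_homo s t : s <= t -> m s <= m t.
  move=> st; apply: fine_le => //; apply: le_measure; rewrite ?inE//.
  by apply: setIS; apply: subset_itvl; rewrite bnd_simp.
have m_jump s t : a <= s -> s <= t -> `]s, t] `<=` U -> m t - m s = t - s.
  move=> as_ st sU.
  have -> : m t = m s + (t - s); last by rewrite addrAC subrr add0r.
  apply: EFin_inj; rewrite EFinD !fineK//.
  have -> : U `&` `[a, t] = (U `&` `[a, s]) `|` `]s, t].
    rewrite (@itv_bndbnd_setU _ _ (BLeft a) (BRight s) (BRight t)) ?bnd_simp//.
    by rewrite setIUr; congr (_ `|` _); apply/setIidPr.
  rewrite measureU//.
  - congr (_ + _)%E; have := @lebesgue_measure_itv R `]s, t] => /= ->.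
    by move: st; rewrite lte_fin le_eqVlt => /predU1P[->|->//]; rewrite ltxx subrr.
  - rewrite -subset0 => x [[_ /=]]; rewrite !in_itv/= => /andP[_ xs] /andP[].
    by rewrite ltNge xs.
pose q t := enorm (Y t - Y a) - (g + e) * (t - a) - L * m t.
suff : q b <= 0.
  rewrite /q subr_le0 lerBlDr => /le_trans; apply.
  by rewrite addrC lerD2l ler_wpM2l.
pose A := [set t | a <= t <= b /\ q t <= 0].
have Aa : A a.
  split; first by rewrite lexx.
  by rewrite /q !subrr enorm0 mulr0 subr0 sub0r oppr_le0 mulr_ge0.
have supA : has_sup A.
  by split; [exists a|exists b => t [/andP[_ ?] _]].
pose c := sup A.
have ac : a <= c by apply: ub_le_sup => //; case: supA.
have cb : c <= b by apply: ge_sup => [|t [/andP[_ ?] _]//]; exists a.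
have ic t : c <= t -> t <= b -> a <= t <= b by move=> ct tb; rewrite (le_trans ac ct).
(* The supremum belongs to A: approaching it from the left by t in A, q increases by at most L (c -
   t), as m is monotone. *)
have qc : q c <= 0.
  rewrite leNgt; apply/negP => qc0.
  have L1 : 0 < L + 1 by rewrite ltr_wpDl.
  have d0 : 0 < q c / (L + 1) by rewrite divr_gt0.
  have [t At tc'] := sup_adherent d0 supA.
  have [/andP[at_ tb] qt] := At.
  have tc : t <= c by apply: ub_le_sup => //; case: supA.
  have YY : enorm (Y c - Y a) <= enorm (Y t - Y a) + L * (c - t).
    rewrite (_ : Y c - Y a = (Y t - Y a) + (Y c - Y t)); last by rewrite [RHS]addrC addrA subrK.
    apply: le_trans (enormD _ _) _; rewrite lerD2l.
    apply: le_trans (YL _ _ _ _) _; [by rewrite ac|by rewrite at_|].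
    by rewrite ger0_norm// subr_ge0.
  have mm : L * m t <= L * m c by rewrite ler_wpM2l// m_homo.
  have gg : 0 <= (g + e) * (c - t) by rewrite mulr_ge0 ?subr_ge0// addr_ge0// ltW.
  have ge_ : (g + e) * (c - a) = (g + e) * (t - a) + (g + e) * (c - t) by ring.
  have qcL : q c <= L * (c - t) by move: qt; rewrite /q ge_; lra.
  have : q c < q c.
    apply: le_lt_trans qcL _.
    apply: (@le_lt_trans _ _ (L * (q c / (L + 1)))).
      by rewrite ler_wpM2l//; move: tc'; rewrite -/c; lra.
    by rewrite mulrCA gtr_pMr// ltr_pdivrMr// mul1r ltrDl.
  by rewrite ltxx.
have [bc|{}cb] := leP b c.
  by rewrite (_ : b = c)//; apply/le_anti; rewrite bc cb.
suff [s [cs sb qs]] : exists s, [/\ c < s, s <= b & q s <= q c].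
  have : s <= c.
    apply: ub_le_sup; first by case: supA.
    by split; [apply: ic => //; exact: ltW|exact: le_trans qs qc].
  by rewrite leNgt cs.
(* Beyond c, either U contains a neighbourhood and m grows at unit rate, which pays for the
   Lipschitz growth, or Y is derivable at c with slope at most g. *)
have [Ec|nEc] := pselect (E c).
  have [r r0 rU] : exists2 r, 0 < r & `]c - r, c + r[ `<=` U.
    have /nbhs_ballP[r /= r0 rU] : nbhs c U by apply: open_nbhs_nbhs; split => //; exact: EU.
    exists r => // x; rewrite /= in_itv/= => /andP[h1 h2]; apply: rU.
    by rewrite /ball/= ltr_norml; lra.
  pose s := Num.min b (c + r / 2).
  have cs : c < s by rewrite lt_min cb ltrDl divr_gt0.
  have sb : s <= b by rewrite ge_min lexx.
  have sr : s < c + r.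
    by rewrite gt_min; apply/orP; right; rewrite ltrD2l ltr_pdivrMr// ltr_pMr// ltr1n.
  exists s; split => //.
  have sU : `]c, s] `<=` U.
    by move=> x; rewrite /= in_itv/= => /andP[h1 h2]; apply: rU; rewrite /= in_itv/=; lra.
  have mj := m_jump _ _ ac (ltW cs) sU.
  have YY : enorm (Y s - Y a) <= enorm (Y c - Y a) + L * (s - c).
    rewrite (_ : Y s - Y a = (Y c - Y a) + (Y s - Y c)); last by rewrite [RHS]addrC addrA subrK.
    apply: le_trans (enormD _ _) _; rewrite lerD2l.
    apply: le_trans (YL _ _ _ _) _; [exact: (ic _ (ltW cs) sb)|by apply: ic => //; exact: ltW|].
    by rewrite gtr0_norm// subr_gt0.
  have ge0 : 0 <= (g + e) * (s - c).
    by rewrite mulr_ge0 ?subr_ge0 ?(ltW cs)// addr_ge0// ltW.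
  rewrite /q; have -> : m s = m c + (s - c) by rewrite -mj; ring.
  rewrite (_ : (g + e) * (s - a) = (g + e) * (c - a) + (g + e) * (s - c)); last by ring.
  rewrite mulrDr; lra.
have [dY Yg] : derivable Y c 1 /\ enorm (derive1 Y c) <= g.
  have := contra_not (badE c) nEc; rewrite /= notK; apply; apply: ic => //; exact: ltW.
have [d d0 dH] := derivable_right_bound dY Yg e0.
pose s := Num.min b (c + d / 2).
have cs : c < s by rewrite lt_min cb ltrDl divr_gt0.
have sb : s <= b by rewrite ge_min lexx.
have sd : s < c + d.
  by rewrite gt_min; apply/orP; right; rewrite ltrD2l ltr_pdivrMr// ltr_pMr// ltr1n.
exists s; split => //.
have YY : enorm (Y s - Y a) <= enorm (Y c - Y a) + (g + e) * (s - c).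
  rewrite (_ : Y s - Y a = (Y c - Y a) + (Y s - Y c)); last by rewrite [RHS]addrC addrA subrK.
  by apply: le_trans (enormD _ _) _; rewrite lerD2l dH.
have mm : L * m c <= L * m s by rewrite ler_wpM2l// m_homo// ltW.
rewrite /q (_ : (g + e) * (s - a) = (g + e) * (c - a) + (g + e) * (s - c)); last by ring.
by lra.
Qed.
End Growth.

(** * The singular Gronwall inequality *)

Section Gronwall.
Context {R : realType} {n : nat}.
Notation leb := (leb_measure R).
Implicit Types (Y : R -> 'rV[R]_n) (a b h t T : R).

Definition weighted_sum a T lam h : R :=
  \sum_(k < grid_size T h) h `^ a * acoef a k * expR (- (lam * (k%:R * h))).

(** [lam] solves D lam^(-a/2) = 1 / (2 (b + 1)); h <= 1/lam keeps e^(lam h) below e, and h <= 1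
    keeps the grid within T + 1. *)
Lemma weighted_sum_small a T b : 0 < a < 1 -> 0 <= T -> 0 <= b ->
  exists lam h0 : R, [/\ 0 < lam, 0 < h0 &
    forall h, 0 < h <= h0 -> weighted_sum a T lam h <= (2 * (b + 1))^-1].
Proof.
move=> a01 T0 b0; have /andP[a0 a1] := a01.
pose D := acoef_cst a * expR 1 / (a / 2) * (T + 1) `^ (a / 2).
have T1 : 0 < T + 1 by rewrite ltr_wpDl.
have b1 : 0 < b + 1 by rewrite ltr_wpDl.
have a2 : 0 < a / 2 by rewrite divr_gt0.
have D0 : 0 < D by rewrite !mulr_gt0 ?invr_gt0 ?expR_gt0 ?powR_gt0 ?acoef_cst_gt0.
pose lam := (2 * (b + 1) * D) `^ (a / 2)^-1.
have bD0 : 0 < 2 * (b + 1) * D by apply: mulr_gt0 => //; exact: mulr_gt0.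
have lam0 : 0 < lam by exact: powR_gt0.
exists lam, (Num.min 1 lam^-1); split => //.
  by rewrite lt_min ltr01 invr_gt0.
move=> h /andP[h0]; rewrite le_min => /andP[h1 hlam].
apply: le_trans (sum_acoef_expR_le (grid_size T h) a01 h0 lam0) _.
have lamE : lam `^ (- (a / 2)) = (2 * (b + 1) * D)^-1.
  rewrite powRN /lam -powRrM mulVf ?gt_eqF// powRr1 //; exact: ltW.
have e1 : expR (lam * h) <= expR 1 by rewrite ler_expR -ler_pdivlMl// mulr1.
have e2 : ((grid_size T h)%:R * h) `^ (a / 2) <= (T + 1) `^ (a / 2).
  apply: ge0_ler_powR; rewrite ?nnegrE ?(ltW a2) ?(ltW T1)//.
    by rewrite mulr_ge0// ltW.
  by apply: le_trans (grid_size_le h0 T0) _; rewrite lerD2l.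
apply: (@le_trans _ _ (D * lam `^ (- (a / 2)))).
  rewrite /D [leRHS](_ : _ = acoef_cst a * expR 1 * lam `^ (- (a / 2)) / (a / 2) *
    (T + 1) `^ (a / 2)); last by ring.
  apply: ler_pM => //.
  - by rewrite !mulr_ge0 ?invr_ge0 ?expR_ge0 ?powR_ge0 ?(ltW a2)// ltW// acoef_cst_gt0.
  - exact: powR_ge0.
  - rewrite ler_wpM2r ?invr_ge0 ?(ltW a2)// ler_wpM2r ?powR_ge0//.
    by rewrite ler_wpM2l// ltW// acoef_cst_gt0.
by rewrite lamE [in leLHS]invfM mulrCA divff ?mulr1// gt_eqF.
Qed.

(** A cell straddling 0 is cut down to [0, s], where Y starts from 0; [growth_le] does the rest. *)
Lemma zero_ext_increment Y T L h s g : 0 < h -> s <= T -> Y 0 = 0 -> 0 <= L -> 0 <= g ->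
  (forall s t, 0 <= s <= T -> 0 <= t <= T -> enorm (Y s - Y t) <= L * `|s - t|) ->
  {ae leb, forall t : R, 0 <= t <= s ->
     derivable Y t 1 /\ enorm (derive1 Y t) <= g} ->
  enorm (zero_ext Y s - zero_ext Y (s - h)) <= h * g.
Proof.
move=> h0 sT Y0 L0 g0 YL H.
have sh : s - h < s by rewrite ltrBlDr ltrDl.
have [s0|s0] := leP 0 s; last first.
  rewrite !zero_ext_lt0 ?subrr ?enorm0 ?mulr_ge0// ?(ltW h0)//.
  exact: lt_trans sh s0.
pose r := Num.max 0 (s - h).
have r0 : 0 <= r by rewrite le_max lexx.
have rs : r <= s by rewrite ge_max s0 ltW.
have shr : s - h <= r by rewrite le_max lexx orbT.
have -> : zero_ext Y (s - h) = Y r.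
  have [sh0|sh0] := leP 0 (s - h); first by rewrite zero_ext_ge0// /r max_r.
  by rewrite zero_ext_lt0// /r max_l ?Y0// ltW.
rewrite zero_ext_ge0//.
apply: le_trans (growth_le (L := L) (g := g) rs L0 g0 _ _) _.
- by move=> x y /andP[rx xs] /andP[ry ys]; apply: YL; lra.
- by apply: ae_leb_imp H => t Ht /andP[rt ts]; apply: Ht; lra.
- by rewrite mulrC ler_wpM2r//; lra.
Qed.

(* The supremum S of v t * exp (- lam t) satisfies S <= e + (A + S) / 2. *)
Lemma gronwall a T lam h A b e L B Y (v : R -> R) :
  0 < a < 1 -> 0 <= T -> 0 < lam -> 0 < h ->
  0 <= A -> 0 <= b -> 0 <= e -> 0 <= L ->
  weighted_sum a T lam h <= (2 * (b + 1))^-1 ->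
  Y 0 = 0 ->
  (forall s t, 0 <= s <= T -> 0 <= t <= T -> enorm (Y s - Y t) <= L * `|s - t|) ->
  (forall t, 0 <= t <= T -> 0 <= v t <= B) ->
  {ae leb, forall t : R, 0 <= t <= T ->
     derivable Y t 1 /\ enorm (derive1 Y t) <= A + b * v t} ->
  (forall t, 0 <= t <= T ->
     v t <= e + enorm (fdiff a h (grid_size T h) (zero_ext Y) t)) ->
  forall t, 0 <= t <= T -> v t <= (2 * e + A) * expR (lam * T).
Proof.
move=> a01 T0 lam0 h0 A0 b0 e0 L0 Q Y0 YL vB dY vY.
have /andP[a0 a1] := a01.
(* B makes this set bounded. The conclusion is free of B and L, which may therefore depend on the
   step and on the solution. *)
pose E := [set v t * expR (- (lam * t)) | t in `[0, T]%classic].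
have inT t : 0 <= t <= T -> `[0, T]%classic t by rewrite /= in_itv.
have supE : has_sup E.
  split; first by exists (v 0 * expR (- (lam * 0))), 0 => //; apply: inT; rewrite lexx.
  exists B => x [t /=]; rewrite in_itv/= => tT <-.
  have /andP[v0 vB'] := vB t tT; have /andP[t0 _] := tT.
  apply: le_trans vB'; rewrite ler_piMr// expR_le1 oppr_le0.
  by rewrite mulr_ge0// ltW.
pose S := sup E.
have vS t : 0 <= t <= T -> v t <= S * expR (lam * t).
  move=> tT; rewrite -ler_pdivrMr ?expR_gt0// -expRN.
  by apply: ub_le_sup; [case: supE|exists t => //; exact: inT].
have S0 : 0 <= S.
  have T00 : 0 <= (0 : R) <= T by rewrite lexx.
  have /andP[v0 _] := vB 0 T00.
  by have := vS 0 T00; rewrite mulr0 expR0 mulr1; exact: le_trans.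
set P := grid_size T h.
have TP : T < P%:R * h by exact: grid_size_gt.
have AbS : 0 <= A + b * S by rewrite addr_ge0// mulr_ge0.
have fd t : 0 <= t <= T -> enorm (fdiff a h P (zero_ext Y) t) <=
    (A + b * S) * expR (lam * t) * weighted_sum a T lam h.
  move=> /andP[t0 tT].
  apply: le_trans (enorm_fdiff_le (b := fun k => (A + b * S) *
      expR (lam * (t - k%:R * h))) a0 h0 _ _) _.
  - by rewrite zero_ext_lt0// subr_lt0 (le_lt_trans tT).
  - move=> k kP; set s := t - k%:R * h.
    have -> : t - k.+1%:R * h = s - h by rewrite /s -natr1; ring.
    have sT : s <= T by rewrite lerBlDr (le_trans tT)// lerDl mulr_ge0// ltW.
    apply: (zero_ext_increment h0 sT Y0 L0 _ YL); first by rewrite mulr_ge0 ?expR_ge0.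
    apply: ae_leb_imp dY => r Hr /andP[r0 rs].
    have rT : 0 <= r <= T by rewrite r0 (le_trans rs).
    have [? dr] := Hr rT; split=> //; apply: le_trans dr _.
    have s0 : 0 <= s by exact: le_trans rs.
    have E1 : 1 <= expR (lam * s).
      by apply: le_trans (expR_ge1Dx _); rewrite lerDl mulr_ge0// ltW.
    rewrite mulrDl; apply: lerD; first by rewrite ler_peMr.
    rewrite -mulrA ler_wpM2l//; apply: le_trans (vS r rT) _.
    by rewrite ler_wpM2l// ler_expR ler_wpM2l// ltW.
  - rewrite /weighted_sum mulr_sumr; apply: ler_sum => k _.
    have -> : expR (lam * (t - k%:R * h)) =
        expR (lam * t) * expR (- (lam * (k%:R * h))).
      by rewrite -expRD; congr expR; ring.
    by rewrite le_eqVlt; apply/orP; left; apply/eqP; ring.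
have b1 : 0 < b + 1 by rewrite ltr_wpDl.
have S_le : S <= e + (A + S) / 2.
  apply: ge_sup; first by case: supE.
  move=> x [t /=]; rewrite in_itv/= => tT <-.
  have /andP[t0 _] := tT.
  rewrite expRN ler_pdivrMr ?expR_gt0//; apply: le_trans (vY t tT) _.
  have E1 : 1 <= expR (lam * t).
    by apply: le_trans (expR_ge1Dx _); rewrite lerDl mulr_ge0// ltW.
  rewrite mulrDl; apply: lerD; first by rewrite ler_peMr.
  apply: le_trans (fd t tT) _; rewrite mulrAC ler_wpM2r ?expR_ge0//.
  apply: le_trans (ler_wpM2l AbS Q) _.
  rewrite ler_pdivrMr ?mulr_gt0// mulrA divfK//.
  rewrite [leRHS](_ : _ = A * b + A + (b * S + S)); last by ring.
  have : 0 <= A * b by rewrite mulr_ge0.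
  by lra.
move=> t tT; apply: le_trans (vS t tT) _.
have S2 : S <= 2 * e + A by lra.
have /andP[_ tT'] := tT.
by apply: ler_pM => //; rewrite ?expR_ge0// ler_expR ler_wpM2l// ltW.
Qed.

End Gronwall.

(** * The primitive attached to a solution of the Caputo problem *)

Section CaputoSolution.
Context {R : realType} {n : nat}.
Notation leb := (leb_measure R).
Implicit Types (a h t T : R).

(** The factor of L in [rl_fdiff_lip], with P h replaced by its bound T + 1 for h <= 1. *)
Definition fdiff_error a T h : R :=
  kernel_cst a / Gamma a * h `^ (a / 2) *
    (4 / (a / 2) * (T + 1) `^ (a / 2)).

Lemma fdiff_error_ge0 a T h : 0 < a < 1 -> 0 <= fdiff_error a T h.
Proof.
move=> a01; have /andP[a0 _] := a01.
by rewrite !mulr_ge0 ?invr_ge0 ?powR_ge0 ?(ltW (kernel_cst_gt0 a01)) ?(ltW (Gamma_gt0 a01))//; lra.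
Qed.

(** Y is the normalized [caputo_primitive], whose derivability is part of being a solution; by
    [rl_inverse] its coordinates are the primitives of those of phi, which gives its regularity. The
    error estimate is stated for any Lipschitz constant, since a uniform one is found only later. *)
Lemma caputo_solution_primitive a T (f : R -> 'rV[R]_n -> 'rV[R]_n) x0 x :
  0 < a < 1 -> 0 <= T -> caputo_solution a T f x0 x ->
  exists Y : R -> 'rV[R]_n, [/\ Y 0 = 0,
    exists2 L, 0 <= L & forall s t, 0 <= s <= T -> 0 <= t <= T ->
      enorm (Y s - Y t) <= L * `|s - t|,
    exists2 B, 0 <= B & forall t, 0 <= t <= T -> enorm (x t - x0) <= B,
    {ae leb, forall t : R, 0 <= t <= T ->
      derivable Y t 1 /\ derive1 Y t = f t (x t)} &
    forall L, 0 <= L -> (forall s t, 0 <= s <= T -> 0 <= t <= T ->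
        enorm (Y s - Y t) <= L * `|s - t|) ->
      forall h t, 0 < h <= 1 -> 0 <= t <= T ->
      enorm (x t - x0 - fdiff a h (grid_size T h) (zero_ext Y) t) <=
        n%:R * (fdiff_error a T h * L)].
Proof.
move=> a01 T0 [[phi [mphi [M0 bM0]] xE] Dx].
have /andP[a0 a1] := a01.
have b01 : 0 < 1 - a < 1 by lra.
pose M := Num.max M0 0.
have M_ge0 : 0 <= M by rewrite le_max lexx orbT.
pose p i s := phi s ord0 i.
have mp i : measurable_fun (`[0, T]%classic : set (leb_type R)) (p i) by exact: mphi.
have bp i : {ae leb, forall t : R, t \in `[0, T] -> `|p i t| <= M}.
  apply: ae_leb_imp bM0 => t Ht /Ht h.
  by rewrite le_max (le_trans (le_coord_enorm _ _) h).
have xiE i t : 0 <= t <= T -> (x t - x0) ord0 i = rl a (p i) t.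
  by move=> tT; rewrite xE ?in_itv// addrAC subrr add0r RL_integral_coord.
have x00 : x 0 = x0.
  apply/eqP; rewrite -subr_eq0; apply/eqP/rowP => i.
  rewrite xiE ?lexx// mxE.
  exact: (rl_at0 T0 M_ge0 (mp i) (bp i)).
have [Y YdefE] : exists Y : R -> 'rV[R]_n,
    Y = fun t => (Gamma (1 - a))^-1 *: caputo_primitive a x t by eexists.
have G0 := Gamma_gt0 b01.
have YE t i : 0 <= t <= T -> Y t ord0 i = prim (p i) t.
  move=> /andP[t0 tT].
  rewrite -(rl_inverse T0 M_ge0 (mp i) (bp i) a01 t0 tT).
  rewrite YdefE /caputo_primitive mxE /rl mxE; congr (_ * _).
  apply: eq_Rintegral => s; rewrite inE/= in_itv/= => /andP[s0 st].
  rewrite mxE /abel_kernel subKr; congr (_ * _).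
  by rewrite x00 xiE// s0 (le_trans st).
have Y0 : Y 0 = 0.
  apply/rowP => i; rewrite YE ?lexx// mxE.
  exact: (prim0 (mp i) (bp i) T0).
have YB s t i : 0 <= s <= T -> 0 <= t <= T ->
    (Y s - Y t) ord0 i = prim (p i) s - prim (p i) t.
  by move=> sT tT; rewrite rV_coordB (YE s i sT) (YE t i tT).
have primL i s t : s <= t -> t <= T -> `|prim (p i) t - prim (p i) s| <= M * (t - s).
  by move=> st tT; exact: (prim_lip M_ge0 (mp i) (bp i) T0 st tT).
exists Y; split => //.
- exists (n%:R * M); first by rewrite mulr_ge0.
  move=> s t sT tT; rewrite -mulrA; apply: enorm_le_cst => i.
  rewrite YB//.
  have /andP[_ sT'] := sT; have /andP[_ tT'] := tT.
  have [st|/ltW ts] := leP s t.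
    rewrite distrC [`|s - t|]distrC [`|t - s|]ger0_norm ?subr_ge0//.
    exact: primL.
  by rewrite [`|s - t|]ger0_norm ?subr_ge0//; exact: primL.
- pose Bi i := projT1 (cid2 (rl_bounded T0 M_ge0 (mp i) (bp i) a01)).
  have Bi0 i : 0 <= Bi i by rewrite /Bi; case: cid2.
  have BiP i t : t <= T -> `|rl a (p i) t| <= Bi i.
    by rewrite /Bi; case: cid2 => B ? H /=; exact: H.
  exists (\sum_i Bi i); first exact: sumr_ge0.
  move=> t tT; apply: le_trans (enorm_le_sum _) _; apply: ler_sum => i _.
  by rewrite xiE// BiP//; case/andP : tT.
- apply: ae_leb_imp Dx => t Ht tT.
  have [dP cE] := Ht tT; rewrite YdefE; split; first exact: derivableZ.
  rewrite -cE /caputo !derive1E.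
  exact: deriveZ.
- move=> L L0 YL h t /andP[h0 h1] tT; apply: enorm_le_cst => i.
  have /andP[t0 tT'] := tT.
  set P := grid_size T h.
  have TP : T < P%:R * h by exact: grid_size_gt.
  have -> : (x t - x0 - fdiff a h P (zero_ext Y) t) ord0 i =
      rl a (p i) t - fdiff a h P (prim (p i)) t.
    rewrite rV_coordB (xiE i t tT) fdiff_coord; congr (_ - _).
    apply: eq_fdiff => // s st.
    have [s0|s0] := leP 0 s.
      by rewrite zero_ext_ge0// YE// s0 (le_trans st).
    by rewrite zero_ext_lt0// mxE prim_lt0.
  have FL r s : r <= s -> s <= T -> `|prim (p i) s - prim (p i) r| <= L * (s - r).
    have pos r' s' : 0 <= r' -> r' <= s' -> s' <= T ->
        `|prim (p i) s' - prim (p i) r'| <= L * (s' - r').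
      move=> r0 rs sT; have rT : 0 <= r' <= T by rewrite r0 (le_trans rs).
      have sT2 : 0 <= s' <= T by rewrite sT (le_trans r0).
      have := le_trans (le_coord_enorm (Y s' - Y r') i) (YL _ _ sT2 rT).
      by rewrite YB// [`|s' - r'|]ger0_norm// subr_ge0.
    move=> rs sT; have [r0|r0] := leP 0 r; first exact: pos.
    rewrite (prim_lt0 _ r0) subr0.
    have [s0|s0] := leP 0 s; last by rewrite prim_lt0// normr0 mulr_ge0// subr_ge0.
    have := pos 0 s (lexx _) s0 sT.
    rewrite (prim0 (mp i) (bp i) T0) !subr0 => /le_trans; apply.
    by rewrite ler_wpM2l// lerBrDr gerDl ltW.
  have tP := le_lt_trans tT' TP.
  apply: le_trans (rl_fdiff_lip T0 M_ge0 (mp i) (bp i) a01 h0 t0 tT' tP FL) _.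
  rewrite /fdiff_error ler_wpM2r// ler_wpM2l//.
    by rewrite !mulr_ge0 ?invr_ge0 ?powR_ge0 ?(ltW (kernel_cst_gt0 a01)) ?(ltW (Gamma_gt0 a01)).
  rewrite ler_wpM2l//; first by rewrite !mulr_ge0// invr_ge0; lra.
  apply: ge0_ler_powR; rewrite ?nnegrE ?mulr_ge0 ?(ltW h0) ?addr_ge0//; [lra|].
  by apply: le_trans (grid_size_le h0 T0) _; rewrite lerD2l.
Qed.

End CaputoSolution.

Section DeriveSub.
Context {R : realType} {V : normedModType R}.
Implicit Types f g : R -> V.

Lemma derivable_sub f g (x : R) : derivable f x 1 -> derivable g x 1 ->
  derivable (fun r => f r - g r) x 1.
Proof. exact: derivableB. Qed.

Lemma derive1B f g (x : R) : derivable f x 1 -> derivable g x 1 ->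
  derive1 (fun r => f r - g r) x = derive1 f x - derive1 g x.
Proof. by move=> df dg; rewrite !derive1E; exact: deriveB. Qed.

End DeriveSub.

Section Bounded.
Context {R : realType} {n : nat}.
Implicit Types (a h t T : R).

(** Supplies the step-dependent bound that makes the supremum in [gronwall] finite. *)
Lemma fdiff_bounded a h P t B (G : R -> 'rV[R]_n) : 0 < a < 1 -> 0 < h ->
  (forall s, s <= t -> enorm (G s) <= B) ->
  enorm (fdiff a h P G t) <= h `^ (a - 1) * (2 * B).
Proof.
move=> a01 h0 GB; rewrite /fdiff enormZ ger0_norm ?powR_ge0//.
rewrite ler_wpM2l ?powR_ge0//; apply: le_trans (enorm_sum _) _.
have B0 : 0 <= B by apply: le_trans (GB t (lexx _)); exact: enorm_ge0.
apply: (@le_trans _ _ (\sum_(j < P) `|acoef (a - 1) j| * B)).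
  apply: ler_sum => j _; rewrite enormZ ler_wpM2l// GB//.
  by rewrite lerBlDr lerDl mulr_ge0// ltW.
by rewrite -mulr_suml ler_wpM2r// sum_normr_acoef.
Qed.

Lemma lipschitz_on_itv_ge0 T (Y : R -> 'rV[R]_n) : lipschitz_on_itv T Y ->
  exists2 L, 0 <= L & forall s t, 0 <= s <= T -> 0 <= t <= T ->
    enorm (Y s - Y t) <= L * `|s - t|.
Proof.
move=> [L YL]; exists (Num.max L 0); first by rewrite le_max lexx orbT.
move=> s t sT tT; apply: le_trans (YL _ _ _ _) _; rewrite ?in_itv//.
by rewrite ler_wpM2r// le_max lexx.
Qed.

End Bounded.

(** * Bounds uniform in x0 and h, then comparison of the two solutions *)

Theorem theorem2 (R : realType) (alpha T R0 : R) (n : nat)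
    (f : R -> 'rV[R]_n -> 'rV[R]_n)
    (alpha01 : 0 < alpha < 1) (T_gt0 : 0 < T) (n_gt0 : (0 < n)%N)
    (R0_gt0 : 0 < R0)
    (f_measurable : forall x : 'rV[R]_n, vmeasurable `[0, T] (fun t => f t x))
    (f_lipschitz : forall r : R, 0 < r ->
       exists2 lambda : R, 0 < lambda &
         forall t : R, t \in `[0, T] ->
         forall x y : 'rV[R]_n, eball n r x -> eball n r y ->
           enorm (f t x - f t y) <= lambda * enorm (x - y))
    (f_growth : exists2 c : R, 0 < c &
       forall t : R, t \in `[0, T] ->
       forall x : 'rV[R]_n,
         enorm (f t x) <= (1 + enorm x) * c) :
  forall eps : R, 0 < eps ->
  exists2 hstar : R, 0 < hstar &
    forall (x0 : 'rV[R]_n) (h : R), eball n R0 x0 -> 0 < h <= hstar ->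
    forall x y : R -> 'rV[R]_n,
      caputo_solution alpha T f x0 x ->
      approx_solution alpha T h f x0 y ->
      forall t : R, t \in `[0, T] ->
        enorm (x t - x0 - h `^ (alpha - 1) *: frac_diff h (1 - alpha) y t)
          <= eps.
Proof.
move=> eps eps0.
have T0 : 0 <= T by exact: ltW.
have /andP[alpha0 alpha1] := alpha01.
have p0 : 0 < alpha / 2 by rewrite divr_gt0.
have [c c0 fc] := f_growth.
have [lam1 [h1 [lam10 h10 W1]]] := weighted_sum_small alpha01 T0 (ltW c0).
pose A := c * (1 + R0).
have A0 : 0 <= A by rewrite mulr_ge0 ?(ltW c0)// addr_ge0// ltW.
(* The Gronwall bound with defect e = 1, for x; it also covers e = 0, for z. It fixes the ball on
   which the Lipschitz constant of f is taken. *)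
pose R1 := (2 + A) * expR (lam1 * T).
have R10 : 0 <= R1 by rewrite mulr_ge0 ?expR_ge0// addr_ge0.
have r0 : 0 < R0 + R1 by rewrite ltr_wpDr.
have [lamf lamf0 flip] := f_lipschitz _ r0.
have [lam2 [h2 [lam20 h20 W2]]] := weighted_sum_small alpha01 T0 (ltW lamf0).
pose M := A + c * R1.
have M0 : 0 <= M by rewrite addr_ge0// mulr_ge0// ltW.
pose K := kernel_cst alpha / Gamma alpha * (4 / (alpha / 2) * (T + 1) `^ (alpha / 2)).
have K0 : 0 <= K.
  rewrite mulr_ge0//; first by rewrite divr_ge0// ltW// ?kernel_cst_gt0 ?Gamma_gt0.
  by rewrite mulr_ge0 ?powR_ge0// divr_ge0// ltW.
have errE h : fdiff_error alpha T h = K * h `^ (alpha / 2).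
  by rewrite /fdiff_error /K; ring.
have small D (e : R) : 0 <= D -> 0 < e ->
    exists2 d, 0 < d & forall h, 0 < h <= d -> D * h `^ (alpha / 2) <= e.
  move=> D0 e0; have D1 : 0 < D + 1 by rewrite ltr_wpDl.
  have q0 : 0 < e / (D + 1) by rewrite divr_gt0.
  exists ((e / (D + 1)) `^ (alpha / 2)^-1); first by rewrite powR_gt0.
  move=> h /andP[h0 hd].
  have : h `^ (alpha / 2) <= e / (D + 1).
    rewrite [leRHS](_ : _ = ((e / (D + 1)) `^ (alpha / 2)^-1) `^ (alpha / 2)); last first.
      by rewrite -powRrM mulVf ?gt_eqF// powRr1// ltW.
    by apply: ge0_ler_powR; rewrite ?nnegrE ?powR_ge0// ltW.
  move/(ler_wpM2l D0)/le_trans; apply.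
  by rewrite mulrCA ler_piMr ?(ltW e0)// ler_pdivrMr// mul1r lerDl.
pose D := 2 * (n%:R * (K * M)) * expR (lam2 * T).
have D0 : 0 <= D.
  apply: mulr_ge0; last exact: expR_ge0.
  by apply: mulr_ge0 => //; apply: mulr_ge0 => //; exact: mulr_ge0.
have [h3 h30 W3] := small D eps D0 eps0.
(* h1 is for the bound on z, h2 for the final Gronwall inequality, h3 for the size of the error and
   1 for the grid. *)
exists (Num.min (Num.min h1 h2) (Num.min h3 1)).
  by rewrite !lt_min h10 h20 h30 ltr01.
move=> x0 h x0R /andP[h0]; rewrite !le_min => /andP[/andP[hh1 hh2] /andP[hh3 hh4]].
move=> x y solx [lipy y0 Dy] t; rewrite in_itv/= => tT.
have [Y [Y0 [LY LY0 YL] [B B0 uB] DY err]] := caputo_solution_primitive alpha01 T0 solx.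
have [Ly Ly0 yL] := lipschitz_on_itv_ge0 lipy.
have growth s v : 0 <= s <= T -> enorm (f s (x0 + v)) <= A + c * enorm v.
  move=> sT; apply: le_trans (fc s _ _) _; first by rewrite in_itv.
  rewrite mulrC /A -mulrDr ler_wpM2l ?(ltW c0)// -addrA lerD2l.
  by apply: le_trans (enormD x0 v) _; rewrite lerD2r.
pose z s := fdiff alpha h (grid_size T h) (zero_ext y) s.
have zE s : 0 <= s <= T -> h `^ (alpha - 1) *: frac_diff h (1 - alpha) y s = z s.
  move=> /andP[s0 sT]; rewrite (@frac_diff_fdiff R n alpha h (grid_size T h))//.
  by apply: le_lt_trans sT _; exact: grid_size_gt.
have {}Dy : {ae leb_measure R, forall s : R, 0 <= s <= T ->
    derivable y s 1 /\ derive1 y s = f s (x0 + z s)}.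
  apply: ae_leb_imp Dy => s Hs sT; have := Hs; rewrite in_itv/= => /(_ sT)[? ->].
  by rewrite zE.
have zR s : 0 <= s <= T -> enorm (z s) <= R1.
  move=> sT.
  have le2 : (2 * 0 + A) * expR (lam1 * T) <= R1.
    by rewrite ler_wpM2r ?expR_ge0// mulr0 lerD2r.
  apply: le_trans le2.
  apply: (gronwall (a := alpha) (h := h) (b := c) (L := Ly) (Y := y)
    (B := h `^ (alpha - 1) * (2 * (Ly * T))) (v := fun s => enorm (z s))) => //.
  - exact: ltW.
  - by apply: W1; rewrite h0.
  - move=> r /andP[r0' rT]; rewrite enorm_ge0/=; apply: fdiff_bounded => //.
    move=> q qr; have [q0|q0] := leP 0 q; last first.
      by rewrite zero_ext_lt0// enorm0 mulr_ge0.
    have qT : q <= T by exact: le_trans rT.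
    rewrite zero_ext_ge0// -[y q]subr0 -y0.
    apply: le_trans (yL _ _ _ _) _; rewrite ?q0 ?lexx//.
    by rewrite subr0 ger0_norm// ler_wpM2l.
  - apply: ae_leb_imp Dy => r Hr rT; have [? ->] := Hr rT.
    by split=> //; exact: growth.
  - by move=> r _; rewrite add0r.
have uR s : 0 <= s <= T -> enorm (x s - x0) <= R1.
  move=> sT.
  have KL0 : 0 <= n%:R * (K * LY) by apply: mulr_ge0 => //; exact: mulr_ge0.
  have [h4 h40 W4] := small _ _ KL0 ltr01.
  (* A step unrelated to h: x involves no step, so k may depend on its Lipschitz constant [LY] and
     make the defect at most 1. *)
  pose k := Num.min h1 (Num.min h4 1).
  have k0 : 0 < k by rewrite !lt_min h10 h40 ltr01.
  have [kh1 kh4 k1] : [/\ k <= h1, k <= h4 & k <= 1].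
    by split; rewrite /k !ge_min lexx ?orbT.
  rewrite /R1 -[X in X + A]mulr1.
  apply: (gronwall (a := alpha) (h := k) (b := c) (L := LY) (Y := Y) (B := B)
    (v := fun s => enorm (x s - x0))) => //.
  - exact: ltW.
  - by apply: W1; rewrite k0.
  - by move=> r rT; rewrite enorm_ge0/= uB.
  - apply: ae_leb_imp DY => r Hr rT; have [? ->] := Hr rT.
    split=> //; rewrite -{1}[x r](subrK x0) addrC; exact: growth.
  - move=> r rT.
    rewrite -{1}[x r - x0](subrK (fdiff alpha k (grid_size T k) (zero_ext Y) r)).
    apply: le_trans (enormD _ _) _; rewrite lerD2r.
    apply: le_trans (err LY LY0 YL k r _ rT) _; first by rewrite k0.
    rewrite errE; apply: le_trans (W4 k _); last by rewrite k0.
    by rewrite le_eqVlt; apply/orP; left; apply/eqP; ring.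
(* With x bounded, the equation bounds the derivative of Y by M, which replaces [LY] in the
   error. *)
have YM s r : 0 <= s <= T -> 0 <= r <= T -> enorm (Y s - Y r) <= M * `|s - r|.
  have pos s' r' : 0 <= s' <= T -> 0 <= r' <= T -> s' <= r' ->
      enorm (Y r' - Y s') <= M * (r' - s').
    move=> /andP[s0 sT] /andP[r0' rT] sr; apply: (growth_le (L := LY)) => //.
      have inT p : s' <= p <= r' -> 0 <= p <= T.
        by move=> /andP[sp pr]; rewrite (le_trans s0 sp) (le_trans pr rT).
      by move=> p q /inT pT /inT qT; exact: YL.
    apply: ae_leb_imp DY => p Hp /andP[sp pr].
    have pT : 0 <= p <= T by rewrite (le_trans s0 sp) (le_trans pr rT).
    have [? ->] := Hp pT; split=> //.
    rewrite -[x p](subrK x0) addrC; apply: le_trans (growth _ _ pT) _.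
    by rewrite lerD2l ler_wpM2l ?(ltW c0)// uR.
  move=> sT rT; have [sr|/ltW rs] := leP s r.
    by rewrite enormB distrC ger0_norm ?subr_ge0//; exact: pos.
  by rewrite ger0_norm ?subr_ge0//; exact: pos.
rewrite zE//.
(* Gronwall for Y - y, whose derivative is f(s, x) - f(s, x0 + z); the defect is the discretization
   error of x alone. *)
have final : enorm (x t - x0 - z t) <=
    (2 * (n%:R * (fdiff_error alpha T h * M)) + 0) * expR (lam2 * T).
  apply: (gronwall (a := alpha) (h := h) (b := lamf) (L := LY + Ly) (Y := fun s => Y s - y s)
    (B := R1 + R1) (v := fun s => enorm (x s - x0 - z s))) => //.
  - exact: ltW.
  - apply: mulr_ge0 => //; apply: mulr_ge0 => //.
    exact: fdiff_error_ge0.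
  - by rewrite addr_ge0.
  - by apply: W2; rewrite h0.
  - by rewrite Y0 y0 subrr.
  - move=> s r sT rT.
    rewrite (_ : _ - _ = (Y s - Y r) - (y s - y r)); last first.
      by rewrite !opprB addrACA [RHS]addrACA; congr (_ + _); rewrite addrC.
    apply: le_trans (enormD _ _) _; rewrite enormN mulrDl.
    by apply: lerD; [exact: YL|exact: yL].
  - move=> s sT; rewrite enorm_ge0/=; apply: le_trans (enormD _ _) _.
    by rewrite enormN; apply: lerD; [exact: uR|exact: zR].
  - apply: ae_leb_imp (ae_leb_and DY Dy) => s [HY Hy] sT.
    have [dY EY] := HY sT; have [dy Ey] := Hy sT.
    split; first exact: (derivable_sub dY dy).
    rewrite add0r (derive1B dY dy) EY Ey.
    have xs : enorm (x s - x0) <= R1 by exact: uR.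
    apply: le_trans (flip s _ _ _ _ _) _.
    + by rewrite in_itv.
    + rewrite /eball/= -[x s](subrK x0) addrC; apply: le_trans (enormD _ _) _.
      by apply: lerD => //; exact: uR.
    + by rewrite /eball/=; apply: le_trans (enormD _ _) _; apply: lerD => //; exact: zR.
    + by rewrite opprD addrA.
  - move=> s sT.
    have -> : fdiff alpha h (grid_size T h) (zero_ext (fun s => Y s - y s)) s =
        fdiff alpha h (grid_size T h) (zero_ext Y) s - z s.
      rewrite -fdiffB; apply: eq_fdiff => // r _.
      by rewrite /zero_ext; case: ifP; rewrite ?subr0.
    set W := fdiff _ _ _ _ _.
    rewrite (_ : x s - x0 - z s = (x s - x0 - W) + (W - z s)); last first.
      by rewrite addrA subrK.
    apply: le_trans (enormD _ _) _; rewrite lerD2r.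
    by apply: err => //; rewrite h0.
apply: le_trans final _; apply: le_trans (W3 h _); last by rewrite h0.
by rewrite errE /D le_eqVlt; apply/orP; left; apply/eqP; ring.
Qed.
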